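(* Let $A=KQ/I$ be a gentle tree algebra over an algebraically closed field $K$, with $n$ vertices in $Q$, and let $T(A)=A\ltimes DA$ be its trivial extension. Then: (1) $T(A)$ is a Brauer star algebra if and only if $A\cong K\vec{A}_n$; (2) $T(A)$ is a Brauer line algebra if and only if $\mathrm{rad}^2 A=0$.
   Context: $D=\mathrm{Hom}_K(-,K)$; $T(A)$ has underlying space $A\oplus DA$ with multiplication $(a,f)(b,g)=(ab,ag+fb)$. Gentle: every vertex of $Q$ has at most two incoming and at most two outgoing arrows; for each arrow $\alpha$ there is at most one arrow $\beta$ with $\alpha\beta\in I$, at most one $\gamma$ with $\gamma\alpha\in I$, at most one $\beta'$ with $\alpha\beta'\notin I$ and at most one $\gamma'$ with $\gamma'\alpha\notin I$ (composable arrows); $I$ is admissible and generated by paths of length 2; gentle tree means $Q$ is a tree. $\vec{A}_n$ is the linearly oriented quiver $1\to2\to\cdots\to n$. Brauer graph algebras: for a finite connected graph $G$ with multiplicity $m\equiv1$ and a cyclic ordering of edges around each vertex, $Q_G$ has vertices the edges of $G$ and an arrow $i\to j$ when $E_j$ immediately follows $E_i$ in the cyclic order around a common vertex; each vertex $v$ of $G$ of degree $\ge2$ yields an oriented cycle $C_v$; $I_G$ is generated by $C_v-C_{v'}$ for the two cycles at a vertex $i$ of $Q_G$ ($v,v'$ the endpoints of $E_i$), $C_v\alpha_1$ for each cycle $C_v=\alpha_1\cdots\alpha_k$ at $i$, and $\alpha\beta$ whenever $\alpha\beta$ lies in no such cycle; $B_G=KQ_G/I_G$. A Brauer line algebra is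 $B_G$ with $m\equiv1$ and $G$ a path graph; a Brauer star algebra is $B_G$ with $m\equiv1$ and $G$ a star (all edges incident to one central vertex).
   Formalization: The formal theorem assumes that Q has n ≥ 2 vertices; for n = 1, T(K) = K[x]/(x²) is not a Brauer star or line algebra with m ≡ 1 under the stated conventions, so both equivalences fail there. *)

(* Defs.v *)
From mathcomp Require Import all_boot all_algebra.
Set Implicit Arguments. Unset Strict Implicit. Unset Printing Implicit Defensive.
Import GRing.Theory.
Local Open Scope ring_scope.

(* fd_mult A i j k = coefficient of b_k in the product b_i b_j.          *)
Record fdalg (K : fieldType) := FDAlg {
  fd_basis : finType;
  fd_mult : fd_basis -> fd_basis -> fd_basis -> K }.
Arguments fd_mult {K} f _ _ _.

Definition vec (K : fieldType) (A : fdalg K) := {ffun fd_basis A -> K}.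

Definition vmul (K : fieldType) (A : fdalg K) (x y : vec A) : vec A :=
  [ffun k => \sum_i \sum_j x i * y j * fd_mult A i j k].

Definition vscale (K : fieldType) (A : fdalg K) (c : K) (x : vec A) : vec A :=
  [ffun k => c * x k].

Definition is_unit_elt (K : fieldType) (A : fdalg K) (u : vec A) : Prop :=
  forall x : vec A, vmul u x = x /\ vmul x u = x.

(* Jacobson radical (element-wise description: x in rad A iff 1 - a x is
   left invertible for every a). *)
Definition in_rad (K : fieldType) (A : fdalg K) (u : vec A) (x : vec A) : Prop :=
  forall a : vec A, exists b : vec A, vmul b (u - vmul a x) = u.

Definition rad_sq_zero (K : fieldType) (A : fdalg K) : Prop :=
  forall u : vec A, is_unit_elt u ->
  forall x y : vec A, in_rad u x -> in_rad u y -> vmul x y = 0.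

(* Trivial extension T(A) = A (+) DA, with basis (basis of A) + (dual basis),
   multiplication (a,f)(b,g) = (ab, ag + fb), (ag)(x) = g(xa), (fb)(x) = f(bx). *)
Definition te_mult (K : fieldType) (A : fdalg K)
  (x y z : (fd_basis A + fd_basis A)%type) : K :=
  match x, y, z with
  | inl i, inl j, inl k => fd_mult A i j k
  | inl p, inr q, inr r => fd_mult A r p q
  | inr q, inl p, inr r => fd_mult A p r q
  | _, _, _ => 0
  end.

Definition triv_ext (K : fieldType) (A : fdalg K) : fdalg K :=
  @FDAlg K (fd_basis A + fd_basis A)%type (@te_mult K A).

(* Paths are written left to right: alpha beta means alpha then beta,    *)
(* i.e. t(alpha) = s(beta).                                              *)
Record quiver := Quiver {
  qv : finType; qa : finType; qs : qa -> qv; qt : qa -> qv }.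

(* a path: starting vertex and list of arrows (trivial path e_x = (x, [::])) *)
Definition qpath (Q : quiver) := (qv Q * seq (qa Q))%type.

Fixpoint valid_from (Q : quiver) (x : qv Q) (s : seq (qa Q)) : bool :=
  match s with
  | [::] => true
  | a :: s' => (qs a == x) && valid_from (qt a) s'
  end.

Definition valid_path (Q : quiver) (p : qpath Q) : bool := valid_from p.1 p.2.

Definition end_vertex (Q : quiver) (p : qpath Q) : qv Q :=
  last p.1 [seq qt a | a <- p.2].

(* formal (finite) K-linear combinations of paths = elements of KQ *)
Definition formal (K : fieldType) (Q : quiver) := seq (K * qpath Q).

Definition valid_formal (K : fieldType) (Q : quiver) (f : formal K Q) : bool :=
  all (fun t => valid_path t.2) f.

Definition coef (K : fieldType) (Q : quiver) (f : formal K Q) (p : qpath Q) : K :=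
  \sum_(t <- f | t.2 == p) t.1.

Definition fmul (K : fieldType) (Q : quiver) (f g : formal K Q) : formal K Q :=
  flatten [seq [seq (x.1 * y.1, (x.2.1, x.2.2 ++ y.2.2))
               | y <- g & end_vertex x.2 == y.2.1] | x <- f].

Definition in_ideal (K : fieldType) (Q : quiver) (rho : formal K Q -> Prop)
  (f : formal K Q) : Prop :=
  exists L : seq (formal K Q * formal K Q * formal K Q),
    (forall t, t \in L ->
       [/\ valid_formal t.1.1, valid_formal t.2 & rho t.1.2]) /\
    (forall p : qpath Q,
       coef f p = \sum_(t <- L) coef (fmul (fmul t.1.1 t.1.2) t.2) p).

Definition eval_path (K : fieldType) (A : fdalg K) (Q : quiver)
  (e : qv Q -> vec A) (a : qa Q -> vec A) (p : qpath Q) : vec A :=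
  foldl (fun acc al => vmul acc (a al)) (e p.1) p.2.

Definition eval_formal (K : fieldType) (A : fdalg K) (Q : quiver)
  (e : qv Q -> vec A) (a : qa Q -> vec A) (f : formal K Q) : vec A :=
  \sum_(t <- f) vscale t.1 (eval_path e a t.2).

(* A is isomorphic to KQ/<rho>: there is a surjective K-algebra homomorphism
   KQ -> A (determined by e, a) whose kernel is the ideal generated by rho. *)
Definition presented_by (K : fieldType) (A : fdalg K) (Q : quiver)
  (rho : formal K Q -> Prop) : Prop :=
  exists (e : qv Q -> vec A) (a : qa Q -> vec A),
    [/\
        forall f g : formal K Q, valid_formal f -> valid_formal g ->
          vmul (eval_formal e a f) (eval_formal e a g)
          = eval_formal e a (fmul f g),
        (* unital: the identity 1 = sum of trivial paths goes to a unit *)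
        is_unit_elt (eval_formal e a [seq (1, (x, [::])) | x <- enum (qv Q)]),
        forall v : vec A, exists f : formal K Q, valid_formal f /\ eval_formal e a f = v
      &
        forall f : formal K Q, valid_formal f ->
          (eval_formal e a f = 0 <-> in_ideal rho f)].

Definition qadj (Q : quiver) : rel (qv Q) :=
  fun x y => [exists a, ((qs a == x) && (qt a == y)) || ((qs a == y) && (qt a == x))].

Definition is_tree_quiver (Q : quiver) : Prop :=
  (forall x y : qv Q, connect (@qadj Q) x y) /\ #|qa Q| + 1 = #|qv Q|.

(* r a b : the length-2 path a b lies in I (meaningful for t a = s b) *)
Definition gentle (Q : quiver) (r : qa Q -> qa Q -> bool) : Prop :=
  [/\ forall x : qv Q, #|[set a | qs a == x]| <= 2 /\ #|[set a | qt a == x]| <= 2,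
      forall a : qa Q, #|[set b | (qt a == qs b) && r a b]| <= 1,
      forall a : qa Q, #|[set c | (qt c == qs a) && r c a]| <= 1,
      forall a : qa Q, #|[set b | (qt a == qs b) && ~~ r a b]| <= 1
    & forall a : qa Q, #|[set c | (qt c == qs a) && ~~ r c a]| <= 1]%N.

Definition length2_rels (K : fieldType) (Q : quiver) (r : qa Q -> qa Q -> bool)
  (g : formal K Q) : Prop :=
  exists a b : qa Q, [/\ qt a = qs b, r a b & g = [:: (1, (qs a, [:: a; b]))]].

Definition no_rels (K : fieldType) (Q : quiver) (g : formal K Q) : Prop := False.

Definition linA (n : nat) : quiver :=
  @Quiver 'I_n {i : 'I_n | (i.+1 < n)%N}
    (fun a => val a) (fun a => Ordinal (valP a)).

(* Brauer graphs (multiplicity identically 1, no loops)                  *)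
Record bgraph := BGraph {
  bV : finType; bE : finType;
  end1 : bE -> bV; end2 : bE -> bV;
  bsucc : bV -> bE -> bE  (* cyclic successor of an edge around a vertex *) }.

Definition incident (G : bgraph) (v : bV G) (e : bE G) : bool :=
  (end1 e == v) || (end2 e == v).

Definition bdeg (G : bgraph) (v : bV G) : nat := #|[set e | incident v e]|.

Definition badj (G : bgraph) : rel (bV G) :=
  fun u v => [exists e, ((end1 e == u) && (end2 e == v)) || ((end1 e == v) && (end2 e == u))].

Definition bg_wf (G : bgraph) : Prop :=
  [/\ forall e : bE G, end1 e != end2 e,
      forall u v : bV G, connect (@badj G) u v,
      forall (v : bV G) (e : bE G), incident v e -> incident v (bsucc v e),
      forall (v : bV G) (e e' : bE G), incident v e -> incident v e' -> bsucc v e = bsucc v e' -> e = e'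
    & forall (v : bV G) (e e' : bE G), incident v e -> incident v e' ->
        exists k, iter k (bsucc v) e = e'].

Definition bq_arrow_pred (G : bgraph) : pred (bV G * bE G) :=
  fun p => incident p.1 p.2 && (1 < bdeg p.1)%N.
Notation bq_arrow G := {p : bV G * bE G | @bq_arrow_pred G p}.

Definition brauer_quiver (G : bgraph) : quiver :=
  @Quiver (bE G) {p : bV G * bE G | @bq_arrow_pred G p}
    (fun a => (val a).2) (fun a => bsucc (val a).1 (val a).2).

Definition around (G : bgraph) (v : bV G) (i : bE G) (k : nat)
  (p : qpath (brauer_quiver G)) : Prop :=
  p.1 = i /\ [seq val a | a <- p.2] = [seq (v, iter j (bsucc v) i) | j <- iota 0 k].

Definition brauer_rels (K : fieldType) (G : bgraph)
  (g : formal K (brauer_quiver G)) : Prop :=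
  (exists (i : bE G) (v v' : bV G) (p q : qpath (brauer_quiver G)),
     [/\ v != v', incident v i && incident v' i, (1 < bdeg v)%N && (1 < bdeg v')%N,
         around v i (bdeg v) p /\ around v' i (bdeg v') q
       & g = [:: (1, p); (-1, q)]])
  \/
  (exists (i : bE G) (v : bV G) (p : qpath (brauer_quiver G)),
     [/\ incident v i, (1 < bdeg v)%N, around v i (bdeg v).+1 p & g = [:: (1, p)]])
  \/
  (* alpha beta lying in no cycle *)
  (exists a b : bq_arrow G,
     [/\ bsucc (val a).1 (val a).2 = (val b).2, (val a).1 != (val b).1
       & g = [:: (1, ((val a).2, [:: a; b]))]]).

(* star: all edges incident to a central vertex (simple graph K_{1,m}) *)
Definition is_star (G : bgraph) : Prop :=
  exists c : bV G, (forall e, incident c e) /\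
    injective (fun e : bE G => if end1 e == c then end2 e else end1 e).

Definition is_line (G : bgraph) : Prop :=
  exists m (vt : 'I_m.+1 -> bV G) (ed : 'I_m -> bE G),
    [/\ bijective vt, bijective ed &
        forall k : 'I_m, [set end1 (ed k); end2 (ed k)]
                         = [set vt (widen_ord (leqnSn m) k); vt (lift ord0 k)]].

Definition brauer_star_algebra (K : fieldType) (B : fdalg K) : Prop :=
  exists G : bgraph, [/\ bg_wf G, is_star G & @presented_by K B (brauer_quiver G) (@brauer_rels K G)].

Definition brauer_line_algebra (K : fieldType) (B : fdalg K) : Prop :=
  exists G : bgraph, [/\ bg_wf G, is_line G & @presented_by K B (brauer_quiver G) (@brauer_rels K G)].

(* Main.v *)
Require Import Defs.
From mathcomp Require Import all_boot all_algebra.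
From mathcomp Require Import zify.
Set Implicit Arguments. Unset Strict Implicit. Unset Printing Implicit Defensive.
Import GRing.Theory.
Local Open Scope ring_scope.

(* Write T = T(A) and J = rad T = rad A + DA.  If T is presented by a bound quiver whose
   arrow ideal F is nilpotent then F = J, because F and J are both ideals consisting of
   nilpotent elements with quotient spanned by orthogonal idempotents.  For every nonzero
   path p of A some f in DA satisfies p f <> 0, so T sees all the relations of A:
   - for a Brauer line J^3 = 0, and a nonzero path p of length 2 would give a nonzero p f in J^3;
   - for a Brauer star each vertex of the Brauer quiver has one arrow in and one arrow out.
     Comparing T/J and J/J^2 for the two presentations embeds the quiver of A in an oriented
     cycle, so it is linear; and if a product of two consecutive arrows of A starting at x
     were zero, e_x J^2 would lie in e_x J^3, hence vanish, contradicting a f <> 0.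
   Conversely, when A has the stated form its nonzero paths form a multiplicative basis, and
   these together with the dual basis are the paths of the Brauer quiver modulo its relations. *)

(** * Structure constants and trivial extensions *)

(** An isomorphism between [T(A)] and a Brauer graph algebra need not carry vertices to vertices or
    arrows to arrows; it does so only modulo J and, up to scalars, modulo J^2. Idempotents are
    therefore never lifted or conjugated: all comparisons are congruences modulo the filtration
    [Fil], and scalars are read off through the characters of [T(A)/J]. From the Brauer side the
    forward directions use only the shape of the quiver and the fact that long paths vanish; from
    the [A] side they use the independence of the nonzero paths and the nondegenerate pairing of [A]
    with [DA]. In the converse directions the dual vector of a path p behaves like a path from the
    end of p back to its start, completing p to one of the cycles [C_v]. For the linear quiver that
    cycle has n arrows; for radical square zero an arrow and its dual form a cycle of length two, so
    the orientation of the arrow only decides which of the two lies in [A]. The type [fdalg] has no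
    axioms: associativity and nilpotency have to be extracted from a presentation. *)

Section Vectors.
Variables (K : fieldType) (A : fdalg K).
Implicit Types (x y z f g : vec A) (c d : K).

Lemma vscaleE c x k : vscale c x k = c * x k. Proof. by rewrite ffunE. Qed.
Lemma vscaleDr c x y : vscale c (x + y) = vscale c x + vscale c y.
Proof. by apply/ffunP => k; rewrite !ffunE mulrDr. Qed.
Lemma vscaleDl c d x : vscale (c + d) x = vscale c x + vscale d x.
Proof. by apply/ffunP => k; rewrite !ffunE mulrDl. Qed.
Lemma vscale1 x : vscale 1 x = x.
Proof. by apply/ffunP => k; rewrite !ffunE mul1r. Qed.
Lemma vscale0l x : vscale 0 x = 0.
Proof. by apply/ffunP => k; rewrite !ffunE mul0r. Qed.
Lemma vscale0r c : vscale c (0 : vec A) = 0.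
Proof. by apply/ffunP => k; rewrite !ffunE mulr0. Qed.
Lemma vscaleA c d x : vscale c (vscale d x) = vscale (c * d) x.
Proof. by apply/ffunP => k; rewrite !ffunE mulrA. Qed.
Lemma vscaleN1 x : vscale (-1) x = - x.
Proof. by apply/ffunP => k; rewrite !ffunE mulN1r. Qed.
Lemma vscaleNr c x : vscale c (- x) = - vscale c x.
Proof. by apply/ffunP => k; rewrite !ffunE mulrN. Qed.
Lemma vscale_sumr (I : Type) (s : seq I) (P : pred I) c (F : I -> vec A) :
  vscale c (\sum_(i <- s | P i) F i) = \sum_(i <- s | P i) vscale c (F i).
Proof. exact: (big_morph _ (vscaleDr c) (vscale0r c)). Qed.
Lemma vscale_suml (I : Type) (s : seq I) (P : pred I) (F : I -> K) x :
  vscale (\sum_(i <- s | P i) F i) x = \sum_(i <- s | P i) vscale (F i) x.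
Proof. exact: (big_morph (fun c => vscale c x) (fun c d => vscaleDl c d x) (vscale0l x)). Qed.

Lemma vmulDl x y z : vmul (x + y) z = vmul x z + vmul y z.
Proof.
apply/ffunP => k; rewrite !ffunE -big_split; apply: eq_bigr => i _.
by rewrite -big_split; apply: eq_bigr => j _; rewrite ffunE !mulrDl.
Qed.
Lemma vmulDr x y z : vmul x (y + z) = vmul x y + vmul x z.
Proof.
apply/ffunP => k; rewrite !ffunE -big_split; apply: eq_bigr => i _.
by rewrite -big_split; apply: eq_bigr => j _; rewrite ffunE mulrDr !mulrDl.
Qed.
Lemma vmulZl c x y : vmul (vscale c x) y = vscale c (vmul x y).
Proof.
apply/ffunP => k; rewrite !ffunE mulr_sumr; apply: eq_bigr => i _.
by rewrite mulr_sumr; apply: eq_bigr => j _; rewrite ffunE !mulrA.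
Qed.
Lemma vmulZr c x y : vmul x (vscale c y) = vscale c (vmul x y).
Proof.
apply/ffunP => k; rewrite !ffunE mulr_sumr; apply: eq_bigr => i _.
by rewrite mulr_sumr; apply: eq_bigr => j _; rewrite vscaleE mulrCA !mulrA.
Qed.
Lemma vmul0l x : vmul 0 x = 0.
Proof. by rewrite -(vscale0l 0) vmulZl !vscale0l. Qed.
Lemma vmul0r x : vmul x 0 = 0.
Proof. by rewrite -(vscale0l 0) vmulZr !vscale0l. Qed.
Lemma vmulNl x y : vmul (- x) y = - vmul x y.
Proof. by rewrite -!vscaleN1 vmulZl. Qed.
Lemma vmulNr x y : vmul x (- y) = - vmul x y.
Proof. by rewrite -!vscaleN1 vmulZr. Qed.
Lemma vmul_suml (I : Type) (s : seq I) (P : pred I) (F : I -> vec A) y :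
  vmul (\sum_(i <- s | P i) F i) y = \sum_(i <- s | P i) vmul (F i) y.
Proof. exact: (big_morph (fun x => vmul x y) (fun x z => vmulDl x z y) (vmul0l y)). Qed.
Lemma vmul_sumr (I : Type) (s : seq I) (P : pred I) (F : I -> vec A) y :
  vmul y (\sum_(i <- s | P i) F i) = \sum_(i <- s | P i) vmul y (F i).
Proof. exact: (big_morph (vmul y) (vmulDr y) (vmul0r y)). Qed.

Definition dvec (k : fd_basis A) : vec A := [ffun i => (i == k)%:R].

Lemma dvec_sum x : x = \sum_k vscale (x k) (dvec k).
Proof.
apply/ffunP => i; rewrite sum_ffunE (bigD1 i) //= big1 ?addr0 => [|j ji];
  rewrite !ffunE ?eqxx ?mulr1 // eq_sym (negbTE ji) mulr0 //.
Qed.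

Lemma vmul_dvec i j k : vmul (dvec i) (dvec j) k = fd_mult A i j k.
Proof.
rewrite ffunE (bigD1 i) //= [X in _ + X]big1 ?addr0 => [|i' ni]; last first.
  by rewrite big1 // => j' _; rewrite !ffunE (negbTE ni) !mul0r.
rewrite (bigD1 j) //= big1 ?addr0 => [|j' nj]; last first.
  by rewrite !ffunE (negbTE nj) mulr0 !mul0r.
by rewrite !ffunE !eqxx !mul1r.
Qed.

(** An element of [DA] is stored by its coordinates in the dual basis, hence again as a [vec A];
    this is evaluation of such a functional. *)
Definition dpair f x : K := \sum_k f k * x k.

Lemma dpairDl f g x : dpair (f + g) x = dpair f x + dpair g x.
Proof. by rewrite -big_split; apply: eq_bigr => k _; rewrite ffunE mulrDl. Qed.
Lemma dpairDr f x y : dpair f (x + y) = dpair f x + dpair f y.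
Proof. by rewrite -big_split; apply: eq_bigr => k _; rewrite ffunE mulrDr. Qed.
Lemma dpairZr c f x : dpair f (vscale c x) = c * dpair f x.
Proof. by rewrite mulr_sumr; apply: eq_bigr => k _; rewrite ffunE mulrCA. Qed.
Lemma dpair0r f : dpair f 0 = 0.
Proof. by rewrite -(vscale0l 0) dpairZr mul0r. Qed.
Lemma dpair0l x : dpair 0 x = 0.
Proof. by apply: big1 => k _; rewrite ffunE mul0r. Qed.
Lemma dpair_sumr (I : Type) (s : seq I) (P : pred I) f (F : I -> vec A) :
  dpair f (\sum_(i <- s | P i) F i) = \sum_(i <- s | P i) dpair f (F i).
Proof. exact: (big_morph _ (dpairDr f) (dpair0r f)). Qed.
Lemma dpair_dvec f k : dpair f (dvec k) = f k.
Proof.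
rewrite /dpair (bigD1 k) //= big1 ?addr0 => [|i ni]; rewrite ffunE ?eqxx ?mulr1 //.
by rewrite (negbTE ni) mulr0.
Qed.
Lemma dpair_ext f g : (forall x, dpair f x = dpair g x) -> f = g.
Proof. by move=> h; apply/ffunP => k; rewrite -!dpair_dvec. Qed.

Lemma dpair_neq0 x : x != 0 -> exists f, dpair f x != 0.
Proof.
move=> x0; case: (pickP (fun k => x k != 0)) => [k xk|h]; last first.
  by case/eqP: x0; apply/ffunP => k; move/negbFE/eqP: (h k) => ->; rewrite ffunE.
exists (dvec k); rewrite /dpair (bigD1 k) //= big1 ?addr0 => [|i ni].
  by rewrite ffunE eqxx mul1r.
by rewrite ffunE (negbTE ni) mul0r.
Qed.

End Vectors.

(** Functionals such as [lact x g], or the transpose of a linear map, are defined by their values on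
    basis vectors; this recovers their value on an arbitrary vector. *)
Lemma dpair_lin (K : fieldType) (A B : fdalg K) (f : vec A) (F : vec B -> vec A) (x : vec B) :
  (forall y z, F (y + z) = F y + F z) -> (forall c y, F (vscale c y) = vscale c (F y)) ->
  \sum_k dpair f (F (dvec k)) * x k = dpair f (F x).
Proof.
move=> FD FZ; have F0 : F 0 = 0 by rewrite -(vscale0l 0) FZ !vscale0l.
rewrite [in RHS](dvec_sum x) (big_morph F FD F0) dpair_sumr.
by apply: eq_bigr => k _; rewrite FZ dpairZr mulrC.
Qed.

Section TrivialExtension.
Variables (K : fieldType) (A : fdalg K).
Implicit Types (x y z f g : vec A) (c d : K).

(** The bimodule structure of [DA]: here [(x g)(z) = g(z x)], and for [ract] [(f y)(z) = f(y z)]. *)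
Definition lact x g : vec A := [ffun r => dpair g (vmul (dvec r) x)].
Definition ract f y : vec A := [ffun r => dpair f (vmul y (dvec r))].

Lemma dpair_lact x g z : dpair (lact x g) z = dpair g (vmul z x).
Proof.
rewrite -(@dpair_lin _ _ _ g (fun z => vmul z x)); first by apply: eq_bigr => k _; rewrite ffunE.
  by move=> y y'; rewrite vmulDl.
by move=> c y; rewrite vmulZl.
Qed.
Lemma dpair_ract f y z : dpair (ract f y) z = dpair f (vmul y z).
Proof.
rewrite -(@dpair_lin _ _ _ f (vmul y)); first by apply: eq_bigr => k _; rewrite ffunE.
  by move=> z' y'; rewrite vmulDr.
by move=> c y'; rewrite vmulZr.
Qed.

Definition tpair x f : vec (triv_ext A) :=
  [ffun k : fd_basis A + fd_basis A => match k with inl i => x i | inr j => f j end].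
Definition tfst (t : vec (triv_ext A)) : vec A := [ffun i => t (inl i)].
Definition tsnd (t : vec (triv_ext A)) : vec A := [ffun i => t (inr i)].

Lemma tpair_eta t : tpair (tfst t) (tsnd t) = t.
Proof. by apply/ffunP => -[k|k]; rewrite !ffunE. Qed.
Lemma tfst_pair x f : tfst (tpair x f) = x.
Proof. by apply/ffunP => k; rewrite !ffunE. Qed.
Lemma tsnd_pair x f : tsnd (tpair x f) = f.
Proof. by apply/ffunP => k; rewrite !ffunE. Qed.
Lemma tfstD s t : tfst (s + t) = tfst s + tfst t.
Proof. by apply/ffunP => k; rewrite !ffunE. Qed.
Lemma tsndD s t : tsnd (s + t) = tsnd s + tsnd t.
Proof. by apply/ffunP => k; rewrite !ffunE. Qed.
Lemma tfst0 : tfst 0 = 0. Proof. by apply/ffunP => k; rewrite !ffunE. Qed.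
Lemma tsnd0 : tsnd 0 = 0. Proof. by apply/ffunP => k; rewrite !ffunE. Qed.
Lemma tfstZ c t : tfst (vscale c t) = vscale c (tfst t).
Proof. by apply/ffunP => k; rewrite !ffunE. Qed.

Lemma vmul_tpair x f y g :
  vmul (tpair x f) (tpair y g) = tpair (vmul x y) (lact x g + ract f y).
Proof.
have S (F : fd_basis A + fd_basis A -> K) :
    \sum_k F k = \sum_i F (inl i) + \sum_i F (inr i) by rewrite big_sumType.
apply/ffunP => -[k|k]; rewrite !ffunE /= S /=.
  rewrite [X in _ + X]big1 => [|i _]; last first.
    by rewrite big1 // => -[j|j] _; rewrite mulr0.
  rewrite addr0; apply: eq_bigr => i _; rewrite S /= [X in _ + X]big1 ?addr0.
    by apply: eq_bigr => j _; rewrite !ffunE.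
  by move=> j _; rewrite mulr0.
congr (_ + _).
- rewrite [in RHS](dvec_sum x) vmul_sumr dpair_sumr; apply: eq_bigr => i _.
  rewrite S /= big1 ?add0r => [|j _]; last by rewrite mulr0.
  rewrite vmulZr dpairZr mulr_sumr; apply: eq_bigr => j _.
  by rewrite vmul_dvec !ffunE mulrA.
- rewrite [in RHS](dvec_sum y) vmul_suml dpair_sumr.
  transitivity (\sum_i \sum_j f i * y j * fd_mult A j k i).
    apply: eq_bigr => i _; rewrite S /= [X in _ + X]big1 => [|j _]; last by rewrite mulr0.
    by rewrite addr0; apply: eq_bigr => j _; rewrite !ffunE.
  rewrite exchange_big; apply: eq_bigr => i _ /=.
  rewrite vmulZl dpairZr mulr_sumr; apply: eq_bigr => j _.
  by rewrite vmul_dvec mulrCA mulrA.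
Qed.

Lemma tfst_mul s t : tfst (vmul s t) = vmul (tfst s) (tfst t).
Proof. by rewrite -(tpair_eta s) -(tpair_eta t) vmul_tpair !tfst_pair. Qed.

Lemma triv_ext_assoc :
  associative (@vmul K A) -> associative (@vmul K (triv_ext A)).
Proof.
move=> vA s t r; rewrite -(tpair_eta s) -(tpair_eta t) -(tpair_eta r) !vmul_tpair vA.
congr tpair; apply: dpair_ext => z.
rewrite !(dpairDl, dpair_lact, dpair_ract) !vA addrA; congr (_ + _ + _).
Qed.


End TrivialExtension.

(** * Paths and ideals of path algebras *)

Section Paths.
Variable Q : quiver.
Implicit Types (p q : qpath Q) (x : qv Q) (s : seq (qa Q)).

Definition pcat p q : qpath Q := (p.1, p.2 ++ q.2).

Lemma valid_from_cat x s t :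
  valid_from x (s ++ t) = valid_from x s && valid_from (last x [seq qt a | a <- s]) t.
Proof. by elim: s x => //= a s IH x; rewrite IH andbA. Qed.

Lemma valid_pcat p q : valid_path p -> valid_path q -> end_vertex p = q.1 ->
  valid_path (pcat p q).
Proof. move=> vp vq pq; rewrite /valid_path valid_from_cat; apply/andP; split=> //.
by rewrite -/(end_vertex p) pq. Qed.

Lemma end_pcat p q : end_vertex p = q.1 -> end_vertex (pcat p q) = end_vertex q.
Proof.
by rewrite /end_vertex /= map_cat last_cat => ->.
Qed.

Lemma valid_triv x : valid_path ((x, [::]) : qpath Q). Proof. by []. Qed.
Lemma valid_arrow a : valid_path ((qs a, [:: a]) : qpath Q). Proof. by rewrite /valid_path /= eqxx. Qed.

End Paths.

Section Formal.
Variables (K : fieldType) (Q : quiver).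
Implicit Types (f g h : formal K Q) (p q : qpath Q).

Lemma fcoef_nil p : coef ([::] : formal K Q) p = 0. Proof. exact: big_nil. Qed.
Lemma fcoef_cat f g p : coef (f ++ g) p = coef f p + coef g p.
Proof. exact: big_cat. Qed.
Lemma fcoef_cons (t : K * qpath Q) f p : coef (t :: f) p = t.1 * (t.2 == p)%:R + coef f p.
Proof. by rewrite /coef big_cons; case: eqP => _; rewrite ?mulr1 // mulr0 add0r. Qed.
Lemma fcoef1 (c : K) p q : coef [:: (c, p)] q = c * (p == q)%:R.
Proof. by rewrite fcoef_cons fcoef_nil addr0. Qed.
Lemma fcoef_flatten (I : Type) (L : seq I) (F : I -> formal K Q) p :
  coef (flatten [seq F i | i <- L]) p = \sum_(i <- L) coef (F i) p.
Proof.
elim: L => [|i L IH] /=; first by rewrite big_nil fcoef_nil.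
by rewrite big_cons fcoef_cat IH.
Qed.
Lemma fcoef_sum f p : coef f p = \sum_(t <- f) t.1 * (t.2 == p)%:R.
Proof. by rewrite /coef big_mkcond; apply: eq_bigr => t _; case: eqP; rewrite (mulr1, mulr0). Qed.
Lemma fcoef_notin f p : (forall t, t \in f -> t.2 != p) -> coef f p = 0.
Proof.
move=> h; rewrite fcoef_sum big_seq big1 // => t /h /negbTE ->; exact: mulr0.
Qed.

Lemma fmulP f g t : t \in fmul f g ->
  exists x y, [/\ x \in f, y \in g & t = (x.1 * y.1, pcat x.2 y.2)]
     /\ end_vertex x.2 = y.2.1.
Proof.
case/flattenP=> s /mapP[x xf ->] /mapP[y]; rewrite mem_filter => /andP[/eqP xy yg] ->.
by exists x, y.
Qed.

Lemma valid_fmul f g : valid_formal f -> valid_formal g -> valid_formal (fmul f g).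
Proof.
move=> /allP vf /allP vg; apply/allP => t /fmulP[x [y [[xf yg ->] xy]]] /=.
by apply: valid_pcat => //; [apply: vf|apply: vg].
Qed.

Lemma fmul1 (c d : K) p q : fmul [:: (c, p)] [:: (d, q)]
  = if end_vertex p == q.1 then [:: (c * d, pcat p q)] else [::].
Proof. by rewrite /fmul /=; case: ifP. Qed.

Lemma big_fmul (M : nmodType) f g (F : K * qpath Q -> M) :
  \sum_(t <- fmul f g) F t =
  \sum_(x <- f) \sum_(y <- g | end_vertex x.2 == y.2.1) F (x.1 * y.1, pcat x.2 y.2).
Proof.
rewrite /fmul; elim: f => [|x f IH] /=; first by rewrite !big_nil.
by rewrite big_cat big_cons IH /= big_map big_filter.
Qed.

End Formal.

Section Ideal.
Variables (K : fieldType) (Q : quiver) (rho : formal K Q -> Prop).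
Implicit Types (f g : formal K Q) (p : qpath Q) (phi psi : qpath Q -> K).

(** Many lists represent the same element of [KQ]. Phrasing membership in the ideal for the
    coefficient function makes sums, scalar multiples and extensionality immediate. *)
Definition ideal_fun phi : Prop :=
  exists L : seq (formal K Q * formal K Q * formal K Q),
    (forall t, t \in L ->
       [/\ valid_formal t.1.1, valid_formal t.2 & rho t.1.2]) /\
    (forall p, phi p = \sum_(t <- L) coef (fmul (fmul t.1.1 t.1.2) t.2) p).

Lemma ideal_fun_ext phi psi : phi =1 psi -> ideal_fun phi -> ideal_fun psi.
Proof. by move=> e [L [h1 h2]]; exists L; split=> // p; rewrite -e h2. Qed.
Lemma ideal_fun0 : ideal_fun (fun=> 0).
Proof. by exists [::]; split=> // p; rewrite big_nil. Qed.
Lemma ideal_funD phi psi : ideal_fun phi -> ideal_fun psi ->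
  ideal_fun (fun p => phi p + psi p).
Proof.
move=> [L [h1 h2]] [M [g1 g2]]; exists (L ++ M); split=> [t|p].
  by rewrite mem_cat => /orP[/h1|/g1].
by rewrite big_cat h2 g2.
Qed.
Lemma ideal_funZ c phi : ideal_fun phi -> ideal_fun (fun p => c * phi p).
Proof.
move=> [L [h1 h2]].
pose sc (f : formal K Q) : formal K Q := [seq (c * t.1, t.2) | t <- f].
exists [seq (sc t.1.1, t.1.2, t.2) | t <- L]; split=> [_ /mapP[t tL ->] /=|p].
  have [v1 v2 v3] := h1 _ tL; split=> //; apply/allP => _ /mapP[w wf ->] /=.
  by move/allP: v1; apply.
rewrite h2 mulr_sumr big_map; apply: eq_bigr => t _ /=.
rewrite !fcoef_sum !big_fmul big_map mulr_sumr; apply: eq_bigr => x _ /=.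
rewrite mulr_sumr; apply: eq_bigr => y _; rewrite mulr_sumr; apply: eq_bigr => z _ /=.
by rewrite !mulrA.
Qed.

(* The only two shapes of relations that occur: zero relations and commutativity relations. *)
Lemma ideal_mono p q r : valid_path p -> valid_path r ->
  end_vertex p = q.1 -> end_vertex q = r.1 -> rho [:: (1, q)] ->
  ideal_fun (fun w => (pcat (pcat p q) r == w)%:R).
Proof.
move=> vp vr pq qr hq; exists [:: ([:: (1, p)], [:: (1, q)], [:: (1, r)])].
split=> [t|w]; first by rewrite inE => /eqP -> /=; rewrite /valid_formal /= vp vr.
rewrite big_seq1 /= fmul1 pq eqxx fmul1 end_pcat // qr eqxx fcoef1.
by rewrite !mul1r.
Qed.

Lemma ideal_diff q q' : q.1 = q'.1 -> end_vertex q = end_vertex q' ->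
  rho [:: (1, q); (-1, q')] -> ideal_fun (fun w => (q == w)%:R - (q' == w)%:R).
Proof.
case: q q' => [x s] [x' s'] /= <- ee hr.
exists [:: ([:: (1, (x, [::]))], [:: (1, (x, s)); (-1, (x, s'))],
            [:: (1, (end_vertex (x, s), [::]))])].
split=> [t|w]; first by rewrite inE => /eqP ->.
rewrite big_seq1 fcoef_sum !big_fmul /= !(big_cons, big_nil) /= !eqxx /pcat /= ?cats0 -ee eqxx.
by rewrite !addr0 !mulr1 !mul1r mulN1r.
Qed.

End Ideal.

(** * Presentations and the path-length filtration *)

Section Eval.
Variables (K : fieldType) (A : fdalg K) (Q : quiver).
Variables (e : qv Q -> vec A) (a : qa Q -> vec A).
Implicit Types (f g : formal K Q) (p q : qpath Q) (x y : vec A).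
Local Notation ev := (eval_path e a).
Local Notation evf := (eval_formal e a).

Lemma evf_cat f g : evf (f ++ g) = evf f + evf g. Proof. exact: big_cat. Qed.
Lemma evf1 c p : evf [:: (c, p)] = vscale c (ev p).
Proof. by rewrite /eval_formal big_seq1. Qed.
Lemma evf_cons t f : evf (t :: f) = vscale t.1 (ev t.2) + evf f.
Proof. exact: big_cons. Qed.

Lemma evf_support (f : formal K Q) (s : seq (qpath Q)) :
  uniq s -> {subset [seq t.2 | t <- f] <= s} ->
  evf f = \sum_(p <- s) vscale (coef f p) (ev p).
Proof.
move=> us; elim: f => [|t f IH] sub.
  rewrite [LHS]big_nil big1 // => p _; rewrite fcoef_nil vscale0l //.
rewrite evf_cons IH => [|p pf]; last by apply: sub; rewrite inE pf orbT.
under [RHS]eq_bigr => p _ do rewrite fcoef_cons vscaleDl.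
rewrite big_split /=; congr (_ + _).
rewrite (big_rem t.2) /=; last by apply: sub; rewrite inE eqxx.
rewrite eqxx mulr1 big_seq big1 ?addr0 // => p.
by rewrite mem_rem_uniq // inE => /andP[/negbTE pt _]; rewrite eq_sym pt mulr0 vscale0l.
Qed.

(** A list may repeat a path or carry cancelling terms, so both values are regrouped along one
    duplicate-free list containing the two supports. *)
Lemma evf_coef f g : coef f =1 coef g -> evf f = evf g.
Proof.
move=> h; pose s := undup [seq t.2 | t <- f ++ g].
have us : uniq s by rewrite undup_uniq.
rewrite (@evf_support f s) // => [|p pf]; last first.
  by rewrite mem_undup map_cat mem_cat pf.
rewrite (@evf_support g s) // => [|p pf]; last first.
  by rewrite mem_undup map_cat mem_cat pf orbT.
by apply: eq_bigr => p _; rewrite h.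
Qed.

Definition path_mul := forall p q, valid_path p -> valid_path q ->
  vmul (ev p) (ev q) = if end_vertex p == q.1 then ev (pcat p q) else 0.

Definition path_span := forall v : vec A, exists f, valid_formal f /\ evf f = v.

Lemma evf_fmul f g : path_mul -> valid_formal f -> valid_formal g ->
  vmul (evf f) (evf g) = evf (fmul f g).
Proof.
move=> pm /allP vf /allP vg; rewrite [RHS]big_fmul vmul_suml [LHS]big_seq [RHS]big_seq.
apply: eq_bigr => s /vf vs; rewrite vmulZl vmul_sumr vscale_sumr [RHS]big_mkcond.
rewrite [LHS]big_seq [RHS]big_seq; apply: eq_bigr => t /vg vt.
rewrite vmulZr pm //; case: ifP => _; first by rewrite vscaleA.
by rewrite !vscale0r.
Qed.

(** Associativity is inherited from concatenation of paths, because the values of paths span [A]. *)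
Lemma path_mul_assoc : path_mul -> path_span -> associative (@vmul K A).
Proof.
move=> pm ps x y z.
have [f [vf <-]] := ps x; have [g [vg <-]] := ps y; have [h [vh <-]] := ps z.
rewrite !evf_fmul ?valid_fmul //; apply: evf_coef => p.
rewrite !fcoef_sum !big_fmul; apply: eq_bigr => s _.
rewrite big_mkcond big_fmul [RHS]big_mkcond; apply: eq_bigr => t _ /=.
case: eqP => [st|_]; last by rewrite big1.
by rewrite end_pcat //; apply: eq_bigr => w _ /=; rewrite /pcat /= catA mulrA.
Qed.

End Eval.

Section Presentation.
Variables (K : fieldType) (A : fdalg K) (Q : quiver) (rho : formal K Q -> Prop).

(** The data hidden in [presented_by] made explicit, with multiplicativity tested on single paths
    only and the kernel described through coefficient functions. *)
Definition presentation (e : qv Q -> vec A) (a : qa Q -> vec A) : Prop :=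
  [/\ path_mul e a, is_unit_elt (\sum_x e x), path_span e a &
      forall f : formal K Q, valid_formal f ->
        (eval_formal e a f = 0 <-> ideal_fun rho (coef f))].

Lemma evf_triv (e : qv Q -> vec A) (a : qa Q -> vec A) :
  eval_formal e a [seq (1, (x, [::])) | x <- enum (qv Q)] = \sum_x e x.
Proof. by rewrite /eval_formal big_map big_enum; apply: eq_bigr => x _; rewrite vscale1. Qed.

Lemma presented_byP : presented_by A rho <-> exists e a, presentation e a.
Proof.
split=> [[e [a [h1 h2 h3 h4]]]|[e [a [h1 h2 h3 h4]]]]; exists e, a.
  split=> //; last by rewrite -(evf_triv e a).
  move=> p q vp vq; have := h1 [:: (1, p)] [:: (1, q)].
  rewrite /valid_formal /= vp vq => /(_ isT isT); rewrite !evf1 !vscale1 fmul1 => ->.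
  by case: ifP => _; [rewrite evf1 mulr1 vscale1|rewrite /eval_formal big_nil].
split=> // [f g vf vg|]; last by rewrite evf_triv.
exact: evf_fmul.
Qed.

Variables (e : qv Q -> vec A) (a : qa Q -> vec A).
Hypothesis prs : presentation e a.
Local Notation ev := (eval_path e a).
Local Notation evf := (eval_formal e a).
Implicit Types (p q : qpath Q) (x y v w : vec A).

Let pm : path_mul e a. Proof. by case: prs. Qed.
Lemma pres_assoc : associative (@vmul K A).
Proof. by case: prs => _ _ ps _; apply: path_mul_assoc pm ps. Qed.
Let vA := pres_assoc.

Lemma ev_pcat p q : valid_path p -> valid_path q -> end_vertex p = q.1 ->
  ev (pcat p q) = vmul (ev p) (ev q).
Proof. by move=> vp vq pq; rewrite pm // pq eqxx. Qed.

Lemma idem_mul (i j : qv Q) : vmul (e i) (e j) = if i == j then e i else 0.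
Proof.
have := pm (valid_triv i) (valid_triv j); rewrite /eval_path /= => ->.
by rewrite /end_vertex /=; case: eqP => // ->.
Qed.

Lemma idem_ev i p : valid_path p -> vmul (e i) (ev p) = if i == p.1 then ev p else 0.
Proof.
move=> vp; have := pm (valid_triv i) vp; rewrite {1}/eval_path /= => ->.
rewrite /end_vertex /= /pcat /=; case: eqP => // ->; by case: (p).
Qed.

Lemma ev_idem i p : valid_path p -> vmul (ev p) (e i) = if end_vertex p == i then ev p else 0.
Proof.
move=> vp; have := pm vp (valid_triv i); rewrite {2}/eval_path /= => ->.
by rewrite /pcat cats0; case: eqP => // _; case: (p).
Qed.

(** The image of the k-th power of the arrow ideal. *)
Definition Fil (k : nat) v : Prop := exists f : formal K Q,
  [/\ valid_formal f, all (fun t => k <= size t.2.2)%N f & evf f = v].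

Lemma Fil0 v : Fil 0 v.
Proof. by case: prs => _ _ /(_ v)[f [vf <-]] _; exists f; split=> //; apply/allP. Qed.
Lemma Fil_zero k : Fil k 0.
Proof. by exists [::]; split=> //; rewrite /eval_formal big_nil. Qed.
Lemma Fil_add k v w : Fil k v -> Fil k w -> Fil k (v + w).
Proof.
move=> [f [vf lf <-]] [g [vg lg <-]]; exists (f ++ g).
by rewrite evf_cat /valid_formal !all_cat lf lg; split=> //; apply/andP.
Qed.
Lemma Fil_scale k c v : Fil k v -> Fil k (vscale c v).
Proof.
move=> [f [/allP vf /allP lf <-]]; exists [seq (c * t.1, t.2) | t <- f]; split.
- by apply/allP => _ /mapP[t /vf ? ->].
- by apply/allP => _ /mapP[t /lf ? ->].
- by rewrite /eval_formal big_map vscale_sumr; apply: eq_bigr => t _; rewrite vscaleA.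
Qed.
Lemma Fil_opp k v : Fil k v -> Fil k (- v).
Proof. by rewrite -vscaleN1; apply: Fil_scale. Qed.
Lemma Fil_sub k v w : Fil k v -> Fil k w -> Fil k (v - w).
Proof. by move=> hv /Fil_opp; apply: Fil_add. Qed.
Lemma Fil_path k p : valid_path p -> (k <= size p.2)%N -> Fil k (ev p).
Proof.
by move=> vp kp; exists [:: (1, p)]; rewrite /valid_formal /= vp kp evf1 vscale1.
Qed.

Lemma Fil_ind k (P : vec A -> Prop) : P 0 ->
  (forall v w, P v -> P w -> P (v + w)) -> (forall c v, P v -> P (vscale c v)) ->
  (forall p, valid_path p -> (k <= size p.2)%N -> P (ev p)) ->
  forall v, Fil k v -> P v.
Proof.
move=> P0 PD PZ Pp v [f [+ + <-]]; elim: f => [|t f IH] /=.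
  by rewrite /eval_formal big_nil.
move=> /andP[vt vf] /andP[lt lf]; rewrite evf_cons.
by apply: PD (IH vf lf); apply/PZ/Pp.
Qed.

Lemma Fil_le k l v : (k <= l)%N -> Fil l v -> Fil k v.
Proof.
move=> kl; apply: Fil_ind; [exact: Fil_zero|exact: Fil_add|exact: Fil_scale|].
by move=> p vp lp; apply: Fil_path => //; apply: leq_trans lp.
Qed.

Lemma Fil_mul k l v w : Fil k v -> Fil l w -> Fil (k + l) (vmul v w).
Proof.
move=> hv hw; move: v hv; apply: Fil_ind => [|v v' h h'|c v h|p vp kp].
- by rewrite vmul0l; apply: Fil_zero.
- by rewrite vmulDl; apply: Fil_add.
- by rewrite vmulZl; apply: Fil_scale.
move: w hw; apply: Fil_ind => [|v v' h h'|c v h|q vq lq].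
- by rewrite vmul0r; apply: Fil_zero.
- by rewrite vmulDr; apply: Fil_add.
- by rewrite vmulZr; apply: Fil_scale.
rewrite pm //; case: eqP => [pq|_]; last exact: Fil_zero.
by apply: Fil_path; [apply: valid_pcat|rewrite size_cat leq_add].
Qed.

Lemma Fil_mull k v w : Fil k w -> Fil k (vmul v w).
Proof. exact: (Fil_mul (Fil0 v)). Qed.
Lemma Fil_mulr k v w : Fil k v -> Fil k (vmul v w).
Proof. by move=> hv; have := Fil_mul hv (Fil0 w); rewrite addn0. Qed.

Lemma Fil_decomp v : exists c : qv Q -> K, Fil 1 (v - \sum_i vscale (c i) (e i)).
Proof.
move: v (Fil0 v); apply: Fil_ind => [|v w [c hc] [d hd]|c v [d hd]|[i [|b s]] vp _].
- exists (fun=> 0); rewrite big1 => [|i _]; last exact: vscale0l.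
  by rewrite subr0; apply: Fil_zero.
- exists (fun i => c i + d i); under eq_bigr => i _ do rewrite vscaleDl.
  by rewrite big_split opprD addrACA; apply: Fil_add.
- exists (fun i => c * d i); under eq_bigr => i _ do rewrite -vscaleA.
  by rewrite -vscale_sumr -vscaleN1 vscaleA mulN1r -mulrN1 -vscaleA -vscaleDr vscaleN1;
     apply: Fil_scale.
- exists (fun j => (j == i)%:R); rewrite (bigD1 i) //= big1 => [|j /negbTE ->]; last exact: vscale0l.
  by rewrite eqxx vscale1 addr0 subrr; apply: Fil_zero.
- exists (fun=> 0); rewrite big1 => [|j _]; last exact: vscale0l.
  by rewrite subr0; apply: Fil_path.
Qed.

End Presentation.

(** * Nil ideals and monomial presentations *)

Section NilIdeals.
Variables (K : fieldType) (A : fdalg K).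
Implicit Types (v w x y z : vec A).

Definition ideal_pred (J : vec A -> Prop) : Prop :=
  [/\ J 0, forall v w, J v -> J w -> J (v + w), forall c v, J v -> J (vscale c v),
      forall v w, J w -> J (vmul v w) & forall v w, J v -> J (vmul v w)].

(** Nilpotency is tested on the powers z^(2^k): squaring preserves congruence to an idempotent, and
    it fits the factorisation of 1 - z^2. *)
Definition vsq v := vmul v v.
Definition nil_elt z := exists k, iter k vsq z = 0.

(* Modulo J, a scalar multiple of a suitable left multiple of an element outside J
   is one of the idempotents, and iterated squares of an idempotent never vanish. *)
Lemma nil_ideal_sub (I : finType) (eps : I -> vec A) (J N : vec A -> Prop) :
  associative (@vmul K A) ->
  (forall i j, vmul (eps i) (eps j) = if i == j then eps i else 0) ->
  ideal_pred J ->
  (forall x, exists c : I -> K, J (x - \sum_i vscale (c i) (eps i))) ->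
  (forall c x, N x -> N (vscale c x)) -> (forall y x, N x -> N (vmul y x)) ->
  (forall z, N z -> nil_elt z) -> forall x, N x -> J x.
Proof.
move=> vA idem [J0 JD JZ Jl Jr] dec NZ Nl nil x Nx; have [c Jx] := dec x.
have JN v : J v -> J (- v) by rewrite -vscaleN1; apply: JZ.
rewrite -(subrK (\sum_i vscale (c i) (eps i)) x); apply: (JD) => //.
elim/big_ind: _ => // i _.
have [-> |ci] := eqVneq (c i) 0; first by rewrite vscale0l.
apply: (JZ); pose z := vscale (c i)^-1 (vmul (eps i) x).
have [k zk] : nil_elt z by apply/nil/NZ/Nl.
have Jz : J (z - eps i).
  have -> : z - eps i = vscale (c i)^-1 (vmul (eps i) (x - \sum_j vscale (c j) (eps j))).
    rewrite vmulDr vscaleDr; congr (_ + _); rewrite vmulNr vscaleNr.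
    congr (- _); rewrite vmul_sumr (bigD1 i) //= big1 => [|j ji].
      by rewrite addr0 vmulZr idem eqxx vscaleA mulVf // vscale1.
    by rewrite vmulZr idem eq_sym (negbTE ji) vscale0r.
  exact/JZ/Jl.
have : J (iter k vsq z - eps i).
  elim: k {zk} => //= k; move: (iter _ _ _) => w IH.
  have -> : vsq w - eps i = vmul (w - eps i) w + vmul (eps i) (w - eps i).
    by rewrite vmulDl vmulDr !vmulNl !vmulNr idem eqxx addrA subrK.
  by apply: (JD); [apply: Jr|apply: Jl].
by rewrite zk sub0r => /JN; rewrite opprK.
Qed.

(** Since (1 + z)(1 - z) = 1 - z^2, a left inverse of 1 - z^2 yields one of 1 - z, and z^2 needs one
    squaring less to reach zero. *)
Lemma nil_elt_unit u z : associative (@vmul K A) -> is_unit_elt u -> nil_elt z ->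
  exists b, vmul b (u - z) = u.
Proof.
move=> vA hu [k]; elim: k z => [|k IH] z /=.
  by move=> ->; exists u; rewrite subr0 (hu u).1.
rewrite -iterS iterSr => /IH[b hb]; exists (vmul b (u + z)).
rewrite -vA -[RHS]hb; congr vmul; rewrite vmulDl !vmulDr !vmulNr.
by rewrite !(hu _).1 (hu _).2 addrA subrK.
Qed.

End NilIdeals.

Section FilIdeal.
Variables (K : fieldType) (A : fdalg K) (Q : quiver) (rho : formal K Q -> Prop).
Variables (e : qv Q -> vec A) (a : qa Q -> vec A).
Hypothesis prs : presentation rho e a.

Lemma Fil_ideal k : ideal_pred (Fil e a k).
Proof.
split; [exact: Fil_zero|exact: Fil_add|exact: Fil_scale| |].
  by move=> v w; apply: (Fil_mull prs).
by move=> v w; apply: (Fil_mulr prs).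
Qed.

Lemma Fil_vsq k z : Fil e a 1 z -> Fil e a k.+1 (iter k (@vsq K A) z).
Proof.
move=> hz; elim: k => //= k IH; apply: Fil_le (Fil_mul prs IH IH).
by rewrite addSn ltnS addnS ltnS leq_addr.
Qed.

Lemma Fil_nil N : (forall v, Fil e a N v -> v = 0) ->
  forall z, Fil e a 1 z -> nil_elt z.
Proof. by move=> h z /(Fil_vsq N) hz; exists N; apply/h/Fil_le/hz. Qed.

(** The preimage of [Fil k] under the projection from [T(A)] to [A]; for [k = 1] it is rad A +
    DA. *)
Definition tFil k (t : vec (triv_ext A)) := Fil e a k (tfst t).

Lemma tFil_ideal k : ideal_pred (tFil k).
Proof.
have [F0 FD FZ Fl Fr] := Fil_ideal k; rewrite /tFil; split=> [|v w|c v|v w|v w].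
- by rewrite tfst0.
- by rewrite tfstD; apply: FD.
- by rewrite tfstZ; apply: FZ.
- by rewrite tfst_mul; apply: Fl.
- by rewrite tfst_mul; apply: Fr.
Qed.

Lemma tFil_nil N : (forall v, Fil e a N v -> v = 0) ->
  forall t, tFil 1 t -> nil_elt t.
Proof.
move=> h t ht; exists N.+1; rewrite iterS.
have: tfst (iter N (@vsq K _) t) = 0.
  apply: h; apply: (@Fil_le _ _ _ _ _ N N.+1) => //.
  have -> k : tfst (iter k (@vsq K _) t) = iter k (@vsq K A) (tfst t).
    by elim: k => //= k <-; rewrite /vsq tfst_mul.
  exact: Fil_vsq.
move: (iter _ _ _) => s s0; rewrite /vsq -(tpair_eta s) s0 vmul_tpair vmul0l.
apply/ffunP => -[k|k]; rewrite !ffunE // !vmul0l ?vmul0r !dpair0r addr0 //.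
Qed.

Lemma tidem_mul i j : vmul (tpair (e i) 0) (tpair (e j) 0) = if i == j then tpair (e i) 0 else 0.
Proof.
rewrite vmul_tpair (idem_mul prs).
have -> : lact (e i) 0 + ract 0 (e j) = 0.
  by apply: dpair_ext => z; rewrite dpairDl dpair_lact dpair_ract !dpair0l addr0.
by case: eqP => // _; apply/ffunP => -[k|k]; rewrite !ffunE.
Qed.

Lemma tFil_decomp t : exists c : qv Q -> K,
  tFil 1 (t - \sum_i vscale (c i) (tpair (e i) 0)).
Proof.
have [c hc] := Fil_decomp prs (tfst t); exists c; rewrite /tFil.
have D : {morph @tfst K A : x y / x + y >-> x + y} by exact: tfstD.
rewrite tfstD -vscaleN1 tfstZ vscaleN1 (big_morph _ D (tfst0 _)).
by under eq_bigr => i _ do rewrite tfstZ tfst_pair.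
Qed.

End FilIdeal.

(** * Quadratic monomial presentations: basis of paths, nilpotency, radical *)

Section Monomial.
Variables (K : fieldType) (A : fdalg K) (Q : quiver) (r : qa Q -> qa Q -> bool).
Variables (e : qv Q -> vec A) (a : qa Q -> vec A).
Hypothesis prs : presentation (length2_rels r) e a.
Local Notation ev := (eval_path e a).
Local Notation evf := (eval_formal e a).
Local Notation Fil := (Fil e a).
Implicit Types (p q : qpath Q) (x y v w : vec A).

Definition relfree (p : qpath Q) := sorted (fun b c => ~~ r b c) p.2.

(** Each term of a product x * bc * y contains the relation bc as consecutive arrows, so a path free
    of relations never occurs in the ideal. *)
Lemma ideal_relfree (phi : qpath Q -> K) p :
  ideal_fun (length2_rels r) phi -> relfree p -> phi p = 0.
Proof.
move=> [L [h ->]] rf; rewrite big_seq big1 // => t /h[_ _ [b [c [_ rbc ->]]]].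
apply: fcoef_notin => _ /fmulP[_ [y [[/fmulP[x [z [[_ zz ->] _]]] _ ->] _]]] /=.
apply/negP => /eqP pE; move: rf; rewrite /relfree -pE /=.
move: zz; rewrite inE => /eqP -> /=; rewrite -catA.
by case: (x.2.2) => [|s0 s] /=; rewrite ?cat_path /= rbc // !andbF.
Qed.

Lemma not_relfreeP (s : seq (qa Q)) : ~~ sorted (fun b c => ~~ r b c) s ->
  exists s1 b c s2, s = s1 ++ [:: b; c] ++ s2 /\ r b c.
Proof.
elim: s => [|b [|c s] IH] //=; rewrite negb_and negbK => /orP[rbc|].
  by exists [::], b, c, s.
by move/IH => [s1 [b' [c' [s2 [-> h]]]]]; exists (b :: s1), b', c', s2.
Qed.

Lemma ev_eq0 p : valid_path p -> (ev p = 0 <-> ~~ relfree p).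
Proof.
move=> vp; have [_ _ _ /(_ [:: (1, p)])] := prs.
rewrite /valid_formal /= vp evf1 vscale1 => /(_ isT) hiff; split=> [/hiff hi|nrf].
  apply/negP => rf; have := ideal_relfree hi rf.
  by rewrite fcoef1 mul1r eqxx => /eqP; rewrite oner_eq0.
apply/hiff; case/not_relfreeP: nrf => s1 [b [c [s2 [ps rbc]]]].
move: vp; rewrite /valid_path ps valid_from_cat /= => /and4P[v1 sb sc v2].
apply: (ideal_fun_ext _ (ideal_mono (p := (p.1, s1)) (q := (qs b, [:: b; c]))
   (r := (qt c, s2)) (rho := length2_rels r) _ _ _ _ _)) => //=; last 1 first.
- by exists b, c; split=> //; rewrite (eqP sc).
- move=> w; rewrite fcoef1 mul1r /pcat /= -catA -ps; by case: (p).
- by rewrite /end_vertex /= -(eqP sb).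
Qed.

Lemma evf_indep (f : formal K Q) p :
  valid_formal f -> evf f = 0 -> relfree p -> coef f p = 0.
Proof. by move=> vf h; apply: ideal_relfree; case: prs => _ _ _ hi; apply/hi. Qed.

(** Subtracting from [f] a representation of its value by paths of length at least [k] gives an
    element of the kernel, and the subtracted terms do not touch shorter paths. *)
Lemma Fil_coef (f : formal K Q) k p : valid_formal f -> Fil k (evf f) ->
  relfree p -> (size p.2 < k)%N -> coef f p = 0.
Proof.
move=> vf [g [vg /allP lg eg]] rf pk.
have /evf_indep/(_ rf) : evf (f ++ [seq (- t.1, t.2) | t <- g]) = 0.
  rewrite evf_cat -eg /eval_formal big_map.
  rewrite -big_split big1 //= => t _.
  by rewrite -vscaleDl subrr vscale0l.
rewrite fcoef_cat [X in _ + X]fcoef_notin ?addr0.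
  apply; rewrite /valid_formal all_cat; apply/andP; split=> //.
  by apply/allP => _ /mapP[t tg ->] /=; move/allP: vg; apply.
move=> _ /mapP[t /lg tg ->] /=; apply: contraTneq pk => <-; by rewrite -leqNgt.
Qed.

Lemma idem_notin_Fil i : ~ Fil 1 (e i).
Proof.
pose f : formal K Q := [:: (1, (i, [::]))].
have -> : e i = evf f by rewrite evf1 vscale1.
move=> h; have /eqP := @Fil_coef f 1 (i, [::]) isT h isT isT.
by rewrite fcoef1 eqxx mul1r oner_eq0.
Qed.

(** A relation-free path of length l has l + 1 prefixes, all relation-free and hence linearly
    independent; so l + 1 is at most the dimension of [A]. Finite dimension thus supplies the
    nilpotency of the arrow ideal. *)
Lemma ev_long p : valid_path p -> (#|fd_basis A| <= size p.2)%N -> ev p = 0.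
Proof.
move=> vp lp; apply/ev_eq0 => //; apply/negP => rf.
pose pre (l : 'I_(size p.2).+1) : qpath Q := (p.1, take l p.2).
pose M : 'M[K]_((size p.2).+1, #|fd_basis A|) := \matrix_(l, j) ev (pre l) (enum_val j).
suff /eqnP rM : row_free M.
  by have := rank_leq_col M; rewrite rM leqNgt ltnS lp.
apply: inj_row_free => c cM; apply/rowP => l; rewrite mxE.
have H : coef [seq (c 0 l', pre l') | l' <- enum 'I_(size p.2).+1] (pre l) = 0.
  apply: evf_indep.
  - apply/allP => _ /mapP[l' _ ->] /=; move: vp; rewrite /valid_path -{1}(cat_take_drop l' p.2).
    by rewrite valid_from_cat => /andP[].
  - apply/ffunP => j; rewrite /eval_formal big_map sum_ffunE [RHS]ffunE.
    have := congr1 (fun m : 'rV_ _ => m 0 (enum_rank j)) cM; rewrite !mxE => E; rewrite -[RHS]E.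
    rewrite big_enum; apply: eq_bigr => l' _; by rewrite !mxE enum_rankK vscaleE.
  - exact: take_sorted rf.
move: H; rewrite fcoef_sum big_map big_enum (bigD1 l) //= eqxx mulr1 big1 ?addr0 // => l' nl.
case: eqP => [[]|]; last by rewrite mulr0.
move/(congr1 size); rewrite !size_take_min => /eqP.
have hl (k : 'I_(size p.2).+1) : minn k (size p.2) = k by apply/minn_idPl; rewrite -ltnS.
by rewrite !hl -[_ == _ :> nat]/(l' == l) (negbTE nl).
Qed.

Lemma Fil_nilpotent v : Fil #|fd_basis A| v -> v = 0.
Proof.
move: v; apply: Fil_ind => [|v w -> ->|c v ->|]; rewrite ?addr0 ?vscale0r //.
exact: ev_long.
Qed.

(** If x had a coordinate c_i other than zero at [e i], then for a = c_i^(-1) e_i the element (1 - a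
    x) e_i would lie in [Fil 1], and a left inverse of 1 - a x would carry it to [e i], which is not
    in [Fil 1]. The other inclusion holds because [Fil 1] is a nil ideal. *)
Lemma rad_Fil u x : is_unit_elt u -> in_rad u x <-> Fil 1 x.
Proof.
move=> hu; have vA := pres_assoc prs; split=> [hx|hx y]; last first.
  apply: nil_elt_unit => //; apply: (Fil_nil prs Fil_nilpotent).
  exact: (Fil_mull prs).
have [c hc] := Fil_decomp prs x.
suff c0 i : c i = 0.
  by move: hc; rewrite big1 ?subr0 // => i _; rewrite c0 vscale0l.
apply/eqP/negPn/negP => ci; apply: (@idem_notin_Fil i).
have [b hb] := hx (vscale (c i)^-1 (e i)).
have -> : e i = vmul b (vmul (u - vmul (vscale (c i)^-1 (e i)) x) (e i)).
  by rewrite vA hb (hu _).1.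
apply: (Fil_mull prs).
have -> : vmul (u - vmul (vscale (c i)^-1 (e i)) x) (e i)
   = - vmul (vscale (c i)^-1 (e i)) (vmul (x - \sum_i vscale (c i) (e i)) (e i)).
  rewrite vmulDl (hu _).1 vmulNl -vA [in RHS]vmulDl [in RHS]vmulDr opprD [in LHS]addrC; congr (_ + _).
  rewrite vmulNl vmulNr opprK vmul_suml (bigD1 i) //= big1 => [|j ji].
    by rewrite addr0 !vmulZl vmulZr (idem_mul prs) eqxx (idem_mul prs) eqxx vscaleA mulVf // vscale1.
  by rewrite vmulZl (idem_mul prs) (negbTE ji) vscale0r.
apply/Fil_opp/(Fil_mull prs); exact: (Fil_mulr prs).
Qed.

Lemma rad_sq_zeroP : rad_sq_zero A <-> (forall b c, qt b = qs c -> r b c).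
Proof.
have [_ hu _ _] := prs.
have v1 b : valid_path ((qs b, [:: b]) : qpath Q) by exact: valid_arrow.
have rE b c : qt b = qs c -> (vmul (ev (qs b, [:: b])) (ev (qs c, [:: c])) = 0 <-> r b c).
  move=> bc; rewrite -(ev_pcat prs) //; apply: iff_trans (ev_eq0 _) _; first exact: valid_pcat.
  by rewrite /relfree /= andbT negbK.
split=> [h b c bc|h u {}hu x y].
  apply/rE => //; apply: (h _ hu); apply/rad_Fil => //; exact: Fil_path.
move=> /(rad_Fil _ hu) hx /(rad_Fil _ hu) hy.
have: Fil 2 (vmul x y) by apply: (@Fil_mul _ _ _ _ _ _ prs 1 1).
move: (vmul x y); apply: Fil_ind => [|v w -> ->|c v ->|]; rewrite ?addr0 ?vscale0r //.
move=> [i [|b [|c s]]] vp //= _; apply/ev_eq0 => //; rewrite /relfree /=.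
by move: vp; rewrite /valid_path /= => /and3P[_ /eqP bc _]; rewrite (h b c).
Qed.

End Monomial.

(** * Comparing two presentations *)

Section Decomp.
Variables (K : fieldType) (A : fdalg K) (Q : quiver) (rho : formal K Q -> Prop).
Variables (e : qv Q -> vec A) (a : qa Q -> vec A).
Hypothesis prs : presentation rho e a.

Lemma Fil1_decomp v : Fil e a 1 v -> exists c : qa Q -> K,
  Fil e a 2 (v - \sum_b vscale (c b) (eval_path e a (qs b, [:: b]))).
Proof.
move: v; apply: Fil_ind => [|v w [c hc] [d hd]|c v [d hd]|[i [|b [|b' s]]] vp //= _].
- exists (fun=> 0); rewrite big1 => [|i _]; last exact: vscale0l.
  by rewrite subr0; apply: Fil_zero.
- exists (fun i => c i + d i); under eq_bigr => i _ do rewrite vscaleDl.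
  by rewrite big_split opprD addrACA; apply: Fil_add.
- exists (fun i => c * d i); under eq_bigr => i _ do rewrite -vscaleA.
  by rewrite -vscale_sumr -vscaleNr -vscaleDr; apply: Fil_scale.
- exists (fun b' => (b' == b)%:R); rewrite (bigD1 b) //= big1 => [|j /negbTE ->]; last exact: vscale0l.
  move: vp; rewrite /valid_path /= andbT => /eqP <-.
  by rewrite eqxx vscale1 addr0 subrr; apply: Fil_zero.
- exists (fun=> 0); rewrite big1 => [|j _]; last exact: vscale0l.
  by rewrite subr0; apply: Fil_path.
Qed.

Lemma ev_cons i b s : valid_path (i, b :: s) ->
  eval_path e a (i, b :: s) = vmul (eval_path e a (qs b, [:: b])) (eval_path e a (qt b, s)).
Proof.
rewrite /valid_path /= => /andP[/eqP <- vs].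
by rewrite -(ev_pcat prs) //; apply: valid_arrow.
Qed.

End Decomp.

Section TwoPresentations.
Variables (K : fieldType) (A : fdalg K) (Q : quiver) (r : qa Q -> qa Q -> bool).
Variables (e : qv Q -> vec A) (a : qa Q -> vec A).
Hypothesis prs : presentation (length2_rels r) e a.
Variables (Q' : quiver) (rho' : formal K Q' -> Prop).
Variables (e' : qv Q' -> vec (triv_ext A)) (a' : qa Q' -> vec (triv_ext A)).
Hypothesis prs' : presentation rho' e' a'.
Variable N : nat.
Hypothesis FilN0 : forall t, Fil e' a' N t -> t = 0.
Local Notation ev := (eval_path e a).
Local Notation ev' := (eval_path e' a').
Local Notation F := (Fil e' a').
Implicit Types (t x y z : vec (triv_ext A)) (f g : vec A).

Let TA := pres_assoc prs'.

(** Both inclusions are instances of [nil_ideal_sub], with the two systems of idempotents exchanging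
    roles. *)
Lemma tFil1E t : tFil e a 1 t <-> F 1 t.
Proof.
split.
- apply: (nil_ideal_sub (eps := e') TA (idem_mul prs') (Fil_ideal prs' 1)).
  + exact: Fil_decomp prs'.
  + by move=> c x; have [_ _ + _ _] := tFil_ideal prs 1; apply.
  + by move=> x y; have [_ _ _ + _] := tFil_ideal prs 1; apply.
  + exact: (tFil_nil prs (Fil_nilpotent prs)).
- apply: (nil_ideal_sub (eps := fun i => tpair (e i) 0) TA (tidem_mul prs) (tFil_ideal prs 1)).
  + exact: tFil_decomp prs.
  + by move=> c x; apply: Fil_scale.
  + by move=> x y; apply: (Fil_mull prs').
  + exact: (Fil_nil prs' FilN0).
Qed.

(** The converse inclusion fails in general: [tFil 2] contains all of [DA], whereas dual vectors may
    be arrows of [T(A)]. *)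
Lemma F2_tFil t : F 2 t -> tFil e a 2 t.
Proof.
have [T0 TD TZ _ _] := tFil_ideal prs 2.
move: t; apply: Fil_ind => // -[i [|b [|c s]]] // vp _.
have vp' : valid_path ((qt b, c :: s) : qpath Q').
  by move: vp; rewrite /valid_path /= => /andP[].
rewrite (ev_cons prs' vp) /tFil tfst_mul; apply: (@Fil_mul _ _ _ _ _ _ prs 1 1).
  by apply/tFil1E/Fil_path => //; apply: valid_arrow.
by apply/tFil1E/Fil_path.
Qed.

Lemma tpair_mul_dual (x f : vec A) : vmul (tpair x 0) (tpair 0 f) = tpair 0 (lact x f).
Proof.
rewrite vmul_tpair vmul0r; congr tpair; apply: dpair_ext => z.
by rewrite dpairDl dpair_ract dpair0l addr0.
Qed.

Lemma tpair_mul0 (x y : vec A) : vmul (tpair x 0) (tpair y 0) = tpair (vmul x y) 0.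
Proof.
rewrite vmul_tpair; congr tpair; apply: dpair_ext => z.
by rewrite dpairDl dpair_ract dpair_lact !dpair0l addr0.
Qed.

Lemma tpair_dual_F1 f : F 1 (tpair 0 f).
Proof. by apply/tFil1E; rewrite /tFil tfst_pair; apply: Fil_zero. Qed.

Lemma tpair_path_F1 p : valid_path p -> (0 < size p.2)%N -> F 1 (tpair (ev p) 0).
Proof. by move=> vp sp; apply/tFil1E; rewrite /tFil tfst_pair; apply: Fil_path. Qed.

(* [f (ev p) != 0] makes [ev p * f] a nonzero element of the socle. *)
Lemma dual_mul_neq0 p : valid_path p -> ev p != 0 ->
  exists f, vmul (tpair (ev p) 0) (tpair 0 f) != 0.
Proof.
move=> vp /dpair_neq0[f hf]; exists f; rewrite tpair_mul_dual; apply: contra_neq hf => E.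
have /(congr1 (fun g => dpair g (e p.1))) := congr1 (@tsnd K A) E.
by rewrite tsnd_pair dpair_lact (idem_ev prs) // eqxx tsnd0 dpair0l.
Qed.

Lemma Loewy3_rels : (N <= 3)%N -> forall b c, qt b = qs c -> r b c.
Proof.
move=> N3 b c bc; apply/negPn/negP => nr.
have vb : valid_path ((qs b, [:: b]) : qpath Q) by exact: valid_arrow.
have vc : valid_path ((qs c, [:: c]) : qpath Q) by exact: valid_arrow.
have vbc : valid_path (pcat (qs b, [:: b]) (qs c, [:: c])) by exact: valid_pcat.
have /(dual_mul_neq0 vbc)[f /eqP] : ev (pcat (qs b, [:: b]) (qs c, [:: c])) != 0.
  by apply/eqP => /(ev_eq0 prs vbc); rewrite /relfree /= nr.
apply; apply/FilN0/(Fil_le N3); rewrite (ev_pcat prs) // -tpair_mul0.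
apply: (@Fil_mul _ _ _ _ _ _ prs' 2 1); last exact: tpair_dual_F1.
by apply: (@Fil_mul _ _ _ _ _ _ prs' 1 1); apply: tpair_path_F1.
Qed.

(** * Brauer quivers with at most one arrow into and out of each vertex *)

Section Uniserial.
Hypothesis out1 : injective (@qs Q').
Hypothesis in1 : injective (@qt Q').
Local Notation E v := (tpair (e v) 0).

(* [x] has coordinate [c] at [v] in T(A)/rad = K^n. *)
Let chi v x c := F 1 (vmul (E v) x - vscale c (E v)).

Let chi_inj v x c d : chi v x c -> chi v x d -> c = d.
Proof.
move=> h1 h2; apply/eqP; rewrite -subr_eq0; apply/negPn/negP => cd.
apply: (@idem_notin_Fil _ _ _ _ _ _ prs v).
have /(Fil_scale (c - d)^-1)/tFil1E := Fil_sub h2 h1.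
have -> (y z w : vec (triv_ext A)) : y - z - (y - w) = w - z.
  by rewrite opprB addrC addrA subrK.
rewrite -vscaleNr -[- E v]vscaleN1 vscaleA mulrN1 -vscaleDl.
by rewrite vscaleA mulVf // vscale1 /tFil tfst_pair.
Qed.

Let chiM v x y c d : chi v x c -> chi v y d -> chi v (vmul x y) (c * d).
Proof.
move=> hc hd; rewrite /chi.
have -> : vmul (E v) (vmul x y) - vscale (c * d) (E v) =
   vmul (vmul (E v) x - vscale c (E v)) y + vscale c (vmul (E v) y - vscale d (E v)).
  by rewrite vmulDl vmulNl vmulZl vscaleDr vscaleNr vscaleA -TA addrA subrK.
by apply: Fil_add; [apply: (Fil_mulr prs')|apply: Fil_scale].
Qed.

Let chi_sum (I : finType) v (x : I -> vec (triv_ext A)) (c d : I -> K) :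
  (forall i, chi v (x i) (d i)) -> chi v (\sum_i vscale (c i) (x i)) (\sum_i c i * d i).
Proof.
move=> h; rewrite /chi vmul_sumr vscale_suml -sumrB.
elim/big_ind: _ => [|x1 y1|i _]; [exact: Fil_zero|exact: Fil_add|].
by rewrite vmulZr -vscaleA -vscaleNr -vscaleDr; apply/Fil_scale/h.
Qed.

Let chi_F1 v x : F 1 x -> chi v x 0.
Proof. by move=> h; rewrite /chi vscale0l subr0; apply: (Fil_mull prs'). Qed.

Let chi_add v x y c d : chi v x c -> chi v y d -> chi v (x + y) (c + d).
Proof. by move=> h1 h2; rewrite /chi vmulDr vscaleDl opprD addrACA; apply: Fil_add. Qed.

Let chi_E v w : chi v (E w) (w == v)%:R.
Proof.
rewrite /chi (tidem_mul prs) eq_sym; case: eqP => _; rewrite ?vscale1 ?vscale0l subrr;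
  exact: Fil_zero.
Qed.

Let chi_dec x : exists c : qv Q -> K, F 1 (x - \sum_v vscale (c v) (E v)) /\
  forall v, chi v x (c v).
Proof.
have [c /tFil1E hc] := tFil_decomp prs x; exists c; split=> // v.
have := chi_add (chi_F1 v hc) (chi_sum (v := v) c (chi_E v)).
rewrite subrK add0r (bigD1 v) //= big1 ?addr0 ?eqxx ?mulr1 // => w /negbTE ->.
exact: mulr0.
Qed.

(** [T(A)/J] is a product of copies of [K] with two complete systems of orthogonal idempotents. The
    coordinates [t i v] of [e' i] are zeros and ones with exactly one 1 for each [v]; its position
    is [phi v]. *)
Lemma vertex_match : exists phi : qv Q -> qv Q', forall v, F 1 (E v - e' (phi v)).
Proof.
have [t ht] : exists t : qv Q' -> qv Q -> K, forall i,
    F 1 (e' i - \sum_v vscale (t i v) (E v)) /\ forall v, chi v (e' i) (t i v).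
  exact: fin_all_exists (fun i => chi_dec (e' i)).
(* The coordinate at [v] is multiplicative, so for fixed [v] the scalars [t i v] are orthogonal
   idempotents of the field: at most one differs from zero. *)
have tt i j v : t i v * t j v = if i == j then t i v else 0.
  apply: chi_inj (chiM ((ht i).2 v) ((ht j).2 v)) _; rewrite (idem_mul prs').
  by case: eqP => _; [apply: (ht i).2|apply: chi_F1; apply: Fil_zero].
have [s hs] : exists s : qv Q -> qv Q' -> K, forall v,
    F 1 (E v - \sum_i vscale (s v i) (e' i)).
  exact: fin_all_exists (fun v => Fil_decomp prs' (E v)).
(* The matrix [s] is a one-sided inverse of [t], so no [v] has all its [t i v] equal to zero; this
   is what makes [phi] exist. *)
have st v w : (w == v)%:R = \sum_i s w i * t i v.
  apply: chi_inj (chi_E v w) _.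
  have := chi_add (chi_F1 v (hs w)) (chi_sum (v := v) (s w) (fun i => (ht i).2 v)).
  by rewrite subrK add0r.
have [phi hphi] : exists phi : qv Q -> qv Q', forall v, t (phi v) v != 0.
  apply: (fin_all_exists (P := fun v i => t i v != 0)) => v.
  case: (pickP (fun i => t i v != 0)) => [i hi|h0]; first by exists i.
  have /eqP := st v v; rewrite eqxx big1 ?oner_eq0 // => i _.
  by move/negbFE/eqP: (h0 i) => ->; rewrite mulr0.
have t1 v : t (phi v) v = 1.
  by have /eqP := tt (phi v) (phi v) v; rewrite eqxx -subr_eq0 -{3}[t _ _]mulr1 -mulrBr
    mulf_eq0 (negbTE (hphi v)) subr_eq0 => /eqP.
have t0 v i : i != phi v -> t i v = 0.
  by move=> /negbTE ni; have := tt i (phi v) v; rewrite ni t1 mulr1.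
have sE v w : s w (phi v) = (w == v)%:R.
  rewrite st (bigD1 (phi v)) //= t1 mulr1 big1 ?addr0 // => i ni.
  by rewrite t0 // mulr0.
exists phi => v.
rewrite -(subrK (\sum_i vscale (s v i) (e' i)) (E v)) -addrA.
apply: Fil_add (hs v) _; rewrite (bigD1 (phi v)) //= sE eqxx vscale1 addrC addKr.
elim/big_ind: _ => [|x1 y1|i ni]; [exact: Fil_zero|exact: Fil_add|].
(* An index in the image of [phi] other than [phi v] has coefficient zero; an index outside the
   image has all coordinates zero, so [e' i] itself lies in [F 1]. *)
case: (pickP (fun w => phi w == i)) => [w /eqP wi|h0].
  rewrite -wi sE; case: eqP => [vw|_]; last by rewrite vscale0l; apply: Fil_zero.
  by move: ni; rewrite vw wi eqxx.
apply: Fil_scale; have := (ht i).1; rewrite big1 ?subr0 // => w _.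
by rewrite t0 ?vscale0l // eq_sym h0.
Qed.

(** Projection to [A] sends [F 2] into the span of paths of length at least two, and there the
    arrows of [Q] stay independent. The next lemma rests on the same fact. *)
Lemma arrow_notin_F2 b : ~ F 2 (tpair (ev (qs b, [:: b])) 0).
Proof.
move/F2_tFil; rewrite /tFil tfst_pair => h.
have vf : valid_formal ([:: (1, (qs b, [:: b]))] : formal K Q).
  by rewrite /valid_formal /= valid_arrow.
have := @Fil_coef _ _ _ _ _ _ prs [:: (1, (qs b, [:: b]))] 2 (qs b, [:: b]) vf.
rewrite evf1 vscale1 => /(_ h isT isT)/eqP.
by rewrite fcoef1 eqxx mul1r oner_eq0.
Qed.

Lemma F2_arrow_comb b b' c c' : b != b' ->
  F 2 (vscale c (tpair (ev (qs b, [:: b])) 0) - vscale c' (tpair (ev (qs b', [:: b'])) 0)) ->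
  c = 0.
Proof.
move=> bb' /F2_tFil; rewrite /tFil -vscaleNr -[- tpair _ _]vscaleN1 vscaleA tfstD !tfstZ !tfst_pair => h.
pose f : formal K Q := [:: (c, (qs b, [:: b])); (c' * -1, (qs b', [:: b']))].
have vf : valid_formal f by rewrite /valid_formal /= !valid_arrow.
have := @Fil_coef _ _ _ _ _ _ prs f 2 (qs b, [:: b]) vf.
rewrite /eval_formal /f !big_cons big_nil addr0 => /(_ h isT isT).
by rewrite !fcoef_cons fcoef_nil addr0 eqxx mulr1 xpair_eqE /= eqseq_cons andbT [b' == b]eq_sym (negbTE bb') andbF mulr0 addr0.
Qed.

(** Modulo [F 2], the image of [b] lies in the span of the arrows of [Q'] from [phi (qs b)] to
    [phi (qt b)]. As [qs] is injective on [Q'] there is at most one, and its coefficient is not zero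
    because [b] is not in [F 2]. *)
Lemma arrow_match (phi : qv Q -> qv Q') (hphi : forall v, F 1 (E v - e' (phi v))) b :
  exists (al : qa Q') (c : K), [/\ qs al = phi (qs b), qt al = phi (qt b), c != 0 &
    F 2 (tpair (ev (qs b, [:: b])) 0 - vscale c (ev' (qs al, [:: al])))].
Proof.
set be := tpair _ 0; have vb := valid_arrow b.
have be1 : F 1 be by apply: tpair_path_F1.
have beE : vmul (E (qs b)) (vmul be (E (qt b))) = be.
  by rewrite !tpair_mul0 (ev_idem prs) // [end_vertex _]/= eqxx (idem_ev prs) // eqxx.
have [c hc] := Fil1_decomp be1.
set i := phi (qs b); set j := phi (qt b).
have va (al : qa Q') : valid_path ((qs al, [:: al]) : qpath Q') by exact: valid_arrow.
have H : F 2 (be - \sum_al vscale (c al)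
     (if (qs al == i) && (qt al == j) then ev' (qs al, [:: al]) else 0)).
  (* Cutting with [e' i] and [e' j] instead of the idempotents of [A] costs two error terms, each a
     product of two elements of [F 1]. *)
  have -> : be - \sum_al vscale (c al)
     (if (qs al == i) && (qt al == j) then ev' (qs al, [:: al]) else 0) =
    vmul (E (qs b) - e' i) (vmul be (E (qt b))) +
    (vmul (e' i) (vmul be (E (qt b) - e' j)) +
     vmul (e' i) (vmul (be - \sum_b vscale (c b) (ev' (qs b, [:: b]))) (e' j))).
    rewrite vmulDl beE vmulNl !vmulDr !vmulNr vmulDl vmulDr vmulNl vmulNr.
    rewrite !addrA !subrK; congr (_ - _).
    rewrite vmul_suml vmul_sumr; apply: eq_bigr => al _; rewrite vmulZl vmulZr; congr vscale.
    rewrite (ev_idem prs') // [end_vertex _]/=; case: (qt al == j); last by rewrite andbF vmul0r.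
    by rewrite (idem_ev prs') //= andbT eq_sym.
  apply: Fil_add.
    by apply: (@Fil_mul _ _ _ _ _ _ prs' 1 1); [apply: hphi|apply: (Fil_mulr prs')].
  apply: Fil_add; apply: (Fil_mull prs').
    by apply: (@Fil_mul _ _ _ _ _ _ prs' 1 1); [|apply: hphi].
  exact: (Fil_mulr prs').
case: (pickP (fun al : qa Q' => [&& qs al == i, qt al == j & c al != 0])) => [al|h0].
  case/and3P=> /eqP si /eqP tj cal; exists al, (c al); split=> //.
  move: H; rewrite (bigD1 al) //= si tj !eqxx big1 ?addr0 // => be' nal.
  by rewrite -si (inj_eq out1) (negbTE nal) /= vscale0r.
case: (@arrow_notin_F2 b); move: H; rewrite big1 ?subr0 // => al _.
move: (h0 al); rewrite andbA; case: (_ && (qt al == j)) => /=; last by rewrite vscale0r.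
by move/negbFE/eqP=> ->; rewrite vscale0l.
Qed.

(** Two arrows of [Q] with a common source, or a common target, match the same arrow of [Q']; they
    would then be proportional modulo [F 2]. *)
Lemma uniserial_inj : injective (@qs Q) /\ injective (@qt Q).
Proof.
have [phi hphi] := vertex_match.
suff H b b' al c c' : c' != 0 ->
    F 2 (tpair (ev (qs b, [:: b])) 0 - vscale c (ev' (qs al, [:: al]))) ->
    F 2 (tpair (ev (qs b', [:: b'])) 0 - vscale c' (ev' (qs al, [:: al]))) -> b = b'.
  split=> b b' bb'; have [al [c [sal tal c0 h]]] := arrow_match hphi b;
    have [al' [c' [sal' tal' c0' h']]] := arrow_match hphi b';
    have E : al' = al by [apply: out1; rewrite sal sal' bb'|apply: in1; rewrite tal tal' bb'].
    by rewrite E in h'; apply: H c0' h h'.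
  by rewrite E in h'; apply: H c0' h h'.
move=> c0 h h'; apply/eqP/negPn/negP => bb'; case/eqP: c0.
(* Cross-multiplying by [c'] and [c] cancels the common arrow [al]. *)
apply: (F2_arrow_comb (c' := c) bb').
have := Fil_sub (Fil_scale c' h) (Fil_scale c h').
rewrite !vscaleDr opprD addrACA !vscaleNr !vscaleA mulrC -[in X in _ + X]opprD subrr.
by rewrite oppr0 addr0.
Qed.

Lemma uniserial_norel b c : qt b = qs c -> ~~ r b c.
Proof.
move=> bc; apply/negP => rbc; have [phi hphi] := vertex_match.
have [al [k [sal tal k0 h]]] := arrow_match hphi b.
have [al' [k' [sal' tal' k0' h']]] := arrow_match hphi c.
have va (g : qa Q') : valid_path ((qs g, [:: g]) : qpath Q') by exact: valid_arrow.
have vb (g : qa Q) : valid_path ((qs g, [:: g]) : qpath Q) by exact: valid_arrow.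
set x := ev' _ in h; set x' := ev' _ in h'; set be := tpair _ _ in h; set ga := tpair _ _ in h'.
have bega : vmul be ga = 0.
  rewrite tpair_mul0 -(ev_pcat prs) // (ev_eq0 prs _).2 //; last by rewrite /relfree /= rbc.
    by apply/ffunP => -[i|i]; rewrite !ffunE.
  exact: valid_pcat.
have x1 : F 1 x by apply: Fil_path.
have ga1 : F 1 ga by apply: tpair_path_F1.
(* [be] and [ga] differ from multiples of [x] and [x'] by elements of [F 2], so with [be ga = 0] the
   product [x x'] consists of errors of order three. *)
have xx : F 3 (vmul x x').
  have -> : vmul x x' = vscale (k * k')^-1 (- (vmul (be - vscale k x) ga +
      vmul (vscale k x) (ga - vscale k' x'))).
    rewrite vmulDl bega vmulNl vmulDr add0r addrA [- _ + _]addrC subrr add0r.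
    by rewrite vmulNr opprK vmulZl vmulZr !vscaleA -mulrA mulVf ?vscale1 // mulf_neq0.
  apply/Fil_scale/Fil_opp/Fil_add; first exact: (@Fil_mul _ _ _ _ _ _ prs' 2 1).
  by apply: (@Fil_mul _ _ _ _ _ _ prs' 1 2) => //; apply: Fil_scale.
(* By uniqueness of outgoing arrows, any path of length [m >= 2] leaving [phi (qs b)] begins with
   [al al']; replacing that prefix by an element of [F 3] gains one step of the filtration. *)
have step m z : (1 < m)%N -> F m z -> F m.+1 (vmul (E (qs b)) z).
  move=> m1 hz; rewrite -(subrK (e' (phi (qs b))) (E (qs b))) vmulDl.
  apply: Fil_add; first by apply: (@Fil_mul _ _ _ _ _ _ prs' 1 m).
  move: z hz; apply: Fil_ind => [|z w|d z|[i s] vp mp].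
  - by rewrite vmul0r; apply: Fil_zero.
  - by rewrite vmulDr; apply: Fil_add.
  - by rewrite vmulZr; apply: Fil_scale.
  rewrite (idem_ev prs') //=; case: eqP => [E|_]; last exact: Fil_zero.
  case: s vp mp => [|g [|g' s]] vp mp; try by move: (leq_trans m1 mp).
  have [gE g'E vs] : [/\ g = al, g' = al' & valid_path ((qt g', s) : qpath Q')].
    move: vp; rewrite /valid_path /= -E -sal => /and3P[/eqP/out1 -> ].
    by rewrite tal bc -sal' => /eqP/out1 ->.
  rewrite (ev_cons prs' vp) (ev_cons prs' (i := qt g)); last first.
    by move: vp; rewrite /valid_path /= => /andP[].
  rewrite TA gE g'E -/x -/x'; apply: (@Fil_le _ _ _ _ _ m.+1 (3 + size s)).
    by move: mp => /=; rewrite !addSn.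
  by apply: (Fil_mul prs') => //; rewrite -g'E; apply: Fil_path.
have /(dual_mul_neq0 (vb b))[f /eqP] : ev (qs b, [:: b]) != 0.
  by apply/eqP => /(ev_eq0 prs (vb b)).
apply; rewrite -/be; set y := vmul be _.
have yE : vmul (E (qs b)) y = y.
  by rewrite TA tpair_mul0 (idem_ev prs) //= eqxx.
(* The element [y] starts in [F 2] and is fixed by its left idempotent, so it climbs through every
   [F m] and must be zero. *)
suff yF m : F m.+2 y by apply/FilN0/Fil_le/(yF N); rewrite !leqW.
elim: m => [|m IH]; last by rewrite -yE; apply: step.
by apply: (@Fil_mul _ _ _ _ _ _ prs' 1 1); [apply: tpair_path_F1|apply: tpair_dual_F1].
Qed.

End Uniserial.
End TwoPresentations.

(** * Presentations from a multiplicative basis *)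

Section StandardBasis.
Variables (K : fieldType) (A : fdalg K) (Q : quiver) (rho : formal K Q -> Prop).
Variables (e : qv Q -> vec A) (a : qa Q -> vec A).
Local Notation ev := (eval_path e a).
Local Notation evf := (eval_formal e a).
Implicit Types (p q : qpath Q) (x y v : vec A).

Hypothesis vA : associative (@vmul K A).
Hypothesis idem : forall i j, vmul (e i) (e j) = if i == j then e i else 0.
Hypothesis arrow_idem : forall b, vmul (a b) (e (qt b)) = a b.

Let ev_idem_r p j : valid_path p ->
  vmul (ev p) (e j) = if end_vertex p == j then ev p else 0.
Proof.
case: p => i s; elim/last_ind: s => [|s b _] vp; first exact: idem.
rewrite /eval_path /= -cats1 foldl_cat /= -vA /end_vertex /= map_cat last_cat /=.
have ab : vmul (a b) (e j) = if qt b == j then a b else 0.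
  by rewrite -[in LHS]arrow_idem -vA idem; case: eqP => _; rewrite ?vmul0r ?arrow_idem.
by rewrite ab; case: eqP => _; rewrite ?vmul0r.
Qed.

Lemma std_path_mul : path_mul e a.
Proof.
move=> p [j s] vp vq; rewrite {2}/eval_path /=.
have -> : forall y z, vmul y (foldl (fun acc al => vmul acc (a al)) z s)
    = foldl (fun acc al => vmul acc (a al)) (vmul y z) s.
  by move=> {vq} y z; elim: s z => //= b s IH z; rewrite IH vA.
rewrite ev_idem_r //; case: eqP => _ /=; first by rewrite /eval_path /= foldl_cat.
by elim: s {vq} => //= b s IH; rewrite vmul0l.
Qed.

Hypothesis unit_e : is_unit_elt (\sum_i e i).
Hypothesis rho0 : forall g, rho g -> valid_formal g /\ evf g = 0.
Variable N : fd_basis A -> qpath Q.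
Hypothesis validN : forall k, valid_path (N k).
Hypothesis evN : forall k, ev (N k) = dvec k.
Hypothesis normal_form : forall p, valid_path p ->
  ideal_fun rho (fun w => (p == w)%:R) \/
  exists k, ideal_fun rho (fun w => (p == w)%:R - (N k == w)%:R).

Let ideal_ev0 (f : formal K Q) : ideal_fun rho (coef f) -> evf f = 0.
Proof.
move=> [L [h hf]].
rewrite (@evf_coef _ _ _ e a f (flatten [seq fmul (fmul t.1.1 t.1.2) t.2 | t <- L])).
  elim: L h {hf} => [|t L IH] h /=; first by rewrite /eval_formal big_nil.
  rewrite evf_cat IH ?addr0 => [|s sL]; last by apply: h; rewrite inE sL orbT.
  have [v1 v2 /rho0[v3 v0]] := h t (mem_head _ _).
  by rewrite -!evf_fmul ?valid_fmul ?v0 ?vmul0r ?vmul0l //; apply: std_path_mul.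
by move=> p; rewrite fcoef_flatten hf.
Qed.

(** The hypothesis [normal_form] makes every [f] congruent, modulo the ideal, to the combination of
    the chosen paths [N k] whose coefficients are the coordinates of its value. If the value is
    zero, [f] lies in the ideal; no dimension count enters. *)
Lemma std_presentation : presentation rho e a.
Proof.
split; [exact: std_path_mul|exact: unit_e| |].
  move=> v; exists [seq (v k, N k) | k <- enum (fd_basis A)]; split.
    by apply/allP => _ /mapP[k _ ->] /=.
  rewrite /eval_formal big_map big_enum [RHS]dvec_sum.
  by apply: eq_bigr => k _; rewrite evN.
move=> f vf; split=> [f0|]; last exact: ideal_ev0.
suff H : ideal_fun rho (fun w => coef f w - \sum_k evf f k * (N k == w)%:R).
  apply: ideal_fun_ext H => w; rewrite big1 ?subr0 // => k _.
  by rewrite f0 ffunE mul0r.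
elim: f vf {f0} => [|[c p] f IH] /= vf.
  apply: ideal_fun_ext (ideal_fun0 rho) => w; rewrite fcoef_nil big1 ?subr0 // => k _.
  by rewrite /eval_formal big_nil ffunE mul0r.
move: vf => /andP[vp /IH{}IH].
have H : ideal_fun rho (fun w => (p == w)%:R - \sum_k ev p k * (N k == w)%:R).
  case: (normal_form vp) => [h|[k h]].
    have p0 : ev p = 0.
      rewrite -[ev p]vscale1 -evf1; apply: ideal_ev0; apply: ideal_fun_ext h => w.
      by rewrite fcoef1 mul1r.
    apply: ideal_fun_ext h => w; rewrite big1 ?subr0 // => k _.
    by rewrite p0 ffunE mul0r.
  have pk : ev p = dvec k.
    apply/eqP; rewrite -subr_eq0; apply/eqP; rewrite -evN -vscaleN1 -[ev p]vscale1.
    rewrite -!evf1 -evf_cat; apply: ideal_ev0; apply: ideal_fun_ext h => w.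
    by rewrite fcoef_cat !fcoef1 mul1r mulN1r.
  apply: ideal_fun_ext h => w; rewrite pk (bigD1 k) //= big1 => [|j jk].
    by rewrite ffunE eqxx mul1r addr0.
  by rewrite ffunE (negbTE jk) mul0r.
apply: ideal_fun_ext (ideal_funD (ideal_funZ c H) IH) => w.
rewrite fcoef_cons evf_cons /= mulrBr addrACA -opprD mulr_sumr -big_split /=.
by congr (_ - _); apply: eq_bigr => k _; rewrite [in RHS]ffunE vscaleE mulrDl mulrA.
Qed.

End StandardBasis.

Lemma unit_basis (K : fieldType) (A : fdalg K) (I : finType) (e : I -> vec A)
    (src tgt : fd_basis A -> I) :
  (forall i k, vmul (e i) (dvec k) = if i == src k then dvec k else 0) ->
  (forall i k, vmul (dvec k) (e i) = if i == tgt k then dvec k else 0) ->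
  is_unit_elt (\sum_i e i).
Proof.
move=> hl hr x; rewrite [X in vmul _ X = X /\ _](dvec_sum x) [X in _ /\ vmul X _ = X](dvec_sum x).
rewrite vmul_sumr vmul_suml; split; apply: eq_bigr => k _.
  rewrite vmulZr vmul_suml (bigD1 (src k)) //= hl eqxx big1 ?addr0 // => i /negbTE ni.
  by rewrite hl ni.
rewrite vmulZl vmul_sumr (bigD1 (tgt k)) //= hr eqxx big1 ?addr0 // => i /negbTE ni.
by rewrite hr ni.
Qed.

(** * Algebra isomorphisms and their effect on trivial extensions *)

Section AlgebraIso.
Variable K : fieldType.
Implicit Types A B : fdalg K.

Definition alg_iso A B := exists (F : vec A -> vec B) (G : vec B -> vec A),
  [/\ forall x y, F (x + y) = F x + F y, forall c x, F (vscale c x) = vscale c (F x),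
      cancel F G, cancel G F & forall x y, F (vmul x y) = vmul (F x) (F y)].

Lemma alg_iso_presented A B (Q : quiver) (rho : formal K Q -> Prop) :
  alg_iso A B -> presented_by A rho -> presented_by B rho.
Proof.
move=> [F [G [FD FZ FK GK FM]]] /presented_byP[e [a [h1 h2 h3 h4]]]; apply/presented_byP.
have F0 : F 0 = 0 by rewrite -(vscale0l 0) FZ !vscale0l.
have FS (I : finType) (x : I -> vec A) : F (\sum_i x i) = \sum_i F (x i).
  exact: (big_morph F FD F0).
have evE p : eval_path (F \o e) (F \o a) p = F (eval_path e a p).
  case: p => i s; rewrite /eval_path /=; elim: s (e i) => //= b s IH v.
  by rewrite -FM IH.
have evfE f : eval_formal (F \o e) (F \o a) f = F (eval_formal e a f).
  rewrite /eval_formal (big_morph F FD F0); apply: eq_bigr => t _.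
  by rewrite FZ evE.
exists (F \o e), (F \o a); split.
- by move=> p q vp vq; rewrite !evE -FM h1 //; case: ifP.
- by move=> x; rewrite -FS -[x]GK -!FM (h2 _).1 (h2 _).2.
- by move=> v; have [f [vf fE]] := h3 (G v); exists f; rewrite evfE fE GK.
- move=> f vf; rewrite evfE; split=> [E|/(h4 _ vf)->//].
  by apply/(h4 _ vf); rewrite -[LHS]FK E -F0 FK.
Qed.

Lemma alg_iso_assoc A B : alg_iso A B -> associative (@vmul K B) -> associative (@vmul K A).
Proof. by move=> [F [G [FD FZ FK GK FM]]] vB x y z; apply: (can_inj FK); rewrite !FM vB. Qed.

Lemma alg_iso_triv_ext A B : alg_iso A B -> alg_iso (triv_ext A) (triv_ext B).
Proof.
move=> [F [G [FD FZ FK GK FM]]].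
have GD x y : G (x + y) = G x + G y by apply: (can_inj FK); rewrite FD !GK.
have GZ c x : G (vscale c x) = vscale c (G x) by apply: (can_inj FK); rewrite FZ !GK.
have GM x y : G (vmul x y) = vmul (G x) (G y) by apply: (can_inj FK); rewrite FM !GK.
(* The dual is contravariant, so the isomorphism acts on [DA] by the transpose of its inverse. *)
pose Fd (f : vec A) : vec B := [ffun k => dpair f (G (dvec k))].
pose Gd (g : vec B) : vec A := [ffun k => dpair g (F (dvec k))].
have FdE f z : dpair (Fd f) z = dpair f (G z).
  by rewrite -(dpair_lin f _ GD GZ); apply: eq_bigr => k _; rewrite ffunE.
have GdE g z : dpair (Gd g) z = dpair g (F z).
  by rewrite -(dpair_lin g _ FD FZ); apply: eq_bigr => k _; rewrite ffunE.
have E (C : fdalg K) (x y f g : vec C) : tpair x f + tpair y g = tpair (x + y) (f + g).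
  by apply/ffunP => -[k|k]; rewrite !ffunE.
have Z (C : fdalg K) c (x f : vec C) : vscale c (tpair x f) = tpair (vscale c x) (vscale c f).
  by apply/ffunP => -[k|k]; rewrite !ffunE.
exists (fun t => tpair (F (tfst t)) (Fd (tsnd t))), (fun t => tpair (G (tfst t)) (Gd (tsnd t))).
split.
- move=> s t; rewrite E tfstD FD tsndD; congr tpair.
  by apply: dpair_ext => z; rewrite !(dpairDl, FdE).
- move=> c t; rewrite Z tfstZ FZ; congr tpair; apply/ffunP => k; rewrite !ffunE mulr_sumr.
  by apply: eq_bigr => i _; rewrite !ffunE mulrA.
- move=> t; rewrite tfst_pair tsnd_pair FK -[RHS]tpair_eta; congr tpair.
  by apply: dpair_ext => z; rewrite GdE FdE FK.
- move=> t; rewrite tfst_pair tsnd_pair GK -[RHS]tpair_eta; congr tpair.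
  by apply: dpair_ext => z; rewrite FdE GdE GK.
- move=> s t; rewrite -(tpair_eta s) -(tpair_eta t) !vmul_tpair !tfst_pair !tsnd_pair.
  rewrite FM; congr tpair; apply: dpair_ext => z.
  by rewrite FdE !dpairDl !(dpair_lact, dpair_ract) !FdE !GM !FK.
Qed.

End AlgebraIso.

(** * Algebras with a multiplicative basis *)

Section MonomialAlgebra.
Variables (K : fieldType) (P : finType) (op : P -> P -> option P).

Definition monalg : fdalg K := @FDAlg K P (fun i j k => (op i j == Some k)%:R).
Local Notation d := (@dvec K monalg).

Lemma monalg_mul i j : vmul (d i) (d j) = if op i j is Some k then d k else 0.
Proof.
apply/ffunP => k; rewrite vmul_dvec /=; case: (op i j) => [l|]; rewrite !ffunE //.
by rewrite eq_sym.
Qed.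

(* [inr q] stands for the dual basis vector of [q]. *)
Definition te_op (x y k : P + P) : bool :=
  match x, y, k with
  | inl i, inl j, inl k => op i j == Some k
  | inl p, inr q, inr r => op r p == Some q
  | inr q, inl p, inr r => op p r == Some q
  | _, _, _ => false
  end.

Local Notation td := (@dvec K (triv_ext monalg)).

Lemma te_opE x y k : fd_mult (triv_ext monalg) x y k = (te_op x y k)%:R.
Proof. by case: x y k => [x|x] [y|y] [k|k]. Qed.

Lemma te_mul x y z : (forall k, te_op x y k = (k == z)) -> vmul (td x) (td y) = td z.
Proof. by move=> h; apply/ffunP => k; rewrite vmul_dvec te_opE h ffunE. Qed.

Lemma te_mul0 x y : (forall k, ~~ te_op x y k) -> vmul (td x) (td y) = 0.
Proof. by move=> h; apply/ffunP => k; rewrite vmul_dvec te_opE (negbTE (h k)) ffunE. Qed.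

Variables (A : fdalg K) (Q : quiver) (r : qa Q -> qa Q -> bool).
Variables (e : qv Q -> vec A) (a : qa Q -> vec A).
Hypothesis prs : presentation (length2_rels r) e a.
Variable N : P -> qpath Q.
Hypothesis N_inj : injective N.
Hypothesis N_path : forall p, valid_path p && relfree r p <-> exists k, p = N k.
Hypothesis N_op : forall i j, if op i j is Some k
  then end_vertex (N i) = (N j).1 /\ N k = pcat (N i) (N j)
  else end_vertex (N i) != (N j).1 \/ ~~ relfree r (pcat (N i) (N j)).
Local Notation ev := (eval_path e a).

(** The map sends a basis element to the value of its path: injective since relation-free paths are
    independent, surjective since all other paths evaluate to zero. *)
Lemma monalg_iso : alg_iso monalg A.
Proof.
pose F (x : vec monalg) : vec A := \sum_k vscale (x k) (ev (N k)).
have FD x y : F (x + y) = F x + F y.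
  by rewrite -big_split; apply: eq_bigr => k _; rewrite ffunE vscaleDl.
have FZ c x : F (vscale c x) = vscale c (F x).
  by rewrite vscale_sumr; apply: eq_bigr => k _; rewrite vscaleE vscaleA.
have Nok k : valid_path (N k) && relfree r (N k) by apply/N_path; exists k.
have vN k : valid_path (N k) by case/andP: (Nok k).
have rN k : relfree r (N k) by case/andP: (Nok k).
have Finj x : F x = 0 -> x = 0.
  pose f : formal K Q := [seq (x k, N k) | k <- enum P].
  have -> : F x = eval_formal e a f by rewrite /eval_formal big_map big_enum.
  move=> Fx; apply/ffunP => k; rewrite ffunE.
  have vf : valid_formal f by apply/allP => _ /mapP[i _ ->] /=.
  have := evf_indep prs vf Fx (rN k).
  rewrite fcoef_sum big_map big_enum (bigD1 k) //= eqxx mulr1 big1 ?addr0 // => i ik.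
  by rewrite (inj_eq N_inj) (negbTE ik) mulr0.
have Fd k : F (d k) = ev (N k).
  rewrite /F (bigD1 k) //= ffunE eqxx vscale1 big1 ?addr0 // => j jk.
  by rewrite ffunE (negbTE jk) vscale0l.
have F0 : F 0 = 0 by rewrite -(vscale0l 0) FZ !vscale0l.
have Fsurj v : exists x, F x == v.
  move: v (Fil0 prs v); apply: Fil_ind => [|v w [x /eqP hx] [y /eqP hy]|c v [x /eqP hx]|p vp _].
  - by exists 0; rewrite F0.
  - by exists (x + y); rewrite FD hx hy.
  - by exists (vscale c x); rewrite FZ hx.
  case rp : (relfree r p).
    have [|k ->] := (N_path p).1; first by rewrite vp rp.
    by exists (d k); rewrite Fd.
  by exists 0; rewrite F0 (ev_eq0 prs vp).2 ?rp.
pose G v : vec monalg := xchoose (Fsurj v).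
have GK : cancel G F by move=> v; apply/eqP/(xchooseP (Fsurj v)).
have Fi x y : F x = F y -> x = y.
  move=> E; apply/eqP; rewrite -subr_eq0; apply/eqP/Finj.
  by rewrite -vscaleN1 FD FZ vscaleN1 E subrr.
exists F, G; split=> // [x|x y]; first by apply: Fi; rewrite GK.
have FS (x' : P -> vec monalg) : F (\sum_i x' i) = \sum_i F (x' i).
  exact: (big_morph F FD F0).
rewrite [in LHS](dvec_sum x) [in LHS](dvec_sum y) vmul_suml FS vmul_suml; apply: eq_bigr => i _.
rewrite vmul_sumr FS vmul_sumr; apply: eq_bigr => j _.
rewrite !vmulZl !vmulZr !FZ; congr (vscale _ (vscale _ _)).
rewrite monalg_mul; have pm : path_mul e a by case: prs.
rewrite pm //; have := N_op i j; case: (op i j) => [k [-> Nk]|].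
  by rewrite eqxx Fd Nk.
rewrite F0; case: eqP => [ij|//] [//|nr].
by rewrite (ev_eq0 prs _).2 //; apply: valid_pcat.
Qed.

End MonomialAlgebra.

(** * Enumerating the vertices of the quiver *)

Section HamiltonianPath.
Variables (T : finType) (e : rel T).
Hypothesis conn : forall x y, connect (fun x y => e x y || e y x) x y.
(** The relation is directed so that arrows and symmetric adjacency are covered alike. An inner
    vertex of a path has no further neighbour; a new neighbour of an end vertex can always be
    attached in the right direction. *)
Hypothesis inner : forall x y z w, e x y -> e y z -> uniq [:: x; y; z] ->
  e y w || e w y -> w \in [:: x; y; z].
Hypothesis left_end : forall x y w, x != y -> e x y -> e x w -> w \in [:: x; y] \/ e w x.
Hypothesis right_end : forall x y w, x != y -> e y x -> e w x -> w \in [:: x; y] \/ e x w.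

(* A longest simple path is closed under adjacency. *)
Lemma hamiltonian_path : (0 < #|T|)%N ->
  exists x s, [/\ uniq (x :: s), path e x s & forall y, y \in x :: s].
Proof.
case/card_gt0P => x0 _.
pose P k := [exists t : k.-tuple T, uniq t && sorted e t].
have Pex : exists k, P k by exists 1%N; apply/existsP; exists [tuple x0].
have Pub k : P k -> (k <= #|T|)%N.
  by case/existsP => t /andP[/card_uniqP ut _]; rewrite -(size_tuple t) -ut max_card.
case: (ex_maxnP Pex Pub) => k /existsP[t /andP[ut st]] kmax.
have tmax l : uniq l -> sorted e l -> (size l <= k)%N.
  move=> ul sl; apply: kmax; apply/existsP; exists (in_tuple l); by rewrite ul.
have [x [s tE]] : exists x s, tval t = x :: s.
  have : (0 < size t)%N by rewrite size_tuple (tmax [:: x0]).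
  by case: (tval t) => // x s; exists x, s.
have closed y w : y \in tval t -> e y w || e w y -> w \in tval t.
  move=> yt yw; apply/negPn/negP => wt.
  have no_ext l : uniq l -> sorted e l -> size l = k.+1 -> False.
    by move=> ul sl szl; have := tmax l ul sl; rewrite szl ltnn.
  case/splitPr: yt (size_tuple t) ut st wt => s1 s2 sz ut st wt.
  have add_l : s1 = [::] -> e w y -> False.
    move=> s10 ewy; apply: (no_ext (w :: s1 ++ y :: s2)); rewrite /= ?sz //.
      by rewrite wt.
    by rewrite s10 /= ewy; move: st; rewrite s10.
  have add_r : s2 = [::] -> e y w -> False.
    move=> s20 eyw; apply: (no_ext (rcons (s1 ++ y :: s2) w)).
    - by rewrite rcons_uniq wt.
    - rewrite s20; move: st; rewrite s20; case: (s1) => [|b l] /=; first by rewrite eyw.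
      by rewrite rcons_path last_cat /= eyw andbT.
    - by rewrite size_rcons sz.
  have wy : w != y by apply: contraNneq wt => ->; rewrite mem_cat mem_head orbT.
  (* The vertex [y] is the first of the path if nothing precedes it and the last if nothing follows;
     there [w] would prolong the path. Elsewhere [inner] forbids [w]. *)
  case/lastP: s1 {sz} ut st wt add_l add_r => [|s1 b] ut st wt add_l add_r.
    case: s2 ut st wt add_l add_r => [|z s2] ut st wt add_l add_r.
      by case/orP: yw; [apply: add_r|apply: add_l].
    case/orP: yw => [eyw|]; last exact: add_l.
    have yz : y != z by move: ut; rewrite /= inE negb_or -andbA => /and3P[].
    have eyz : e y z by move: st => /= /andP[].
    case: (left_end yz eyz eyw) => [wyz|]; last exact: add_l.
    by move: wt; rewrite !inE !negb_or; move: wyz; rewrite !inE => /orP[] ->; rewrite ?andbF.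
  have by1 : b != y.
    by move: ut; rewrite cat_rcons cat_uniq => /and3P[_ _]; rewrite /= inE negb_or => /andP[/andP[]].
  have eby : e b y.
    move: st; rewrite cat_rcons; case: (s1) => [|c l] /=; first by case/andP.
    by rewrite cat_path /= => /and3P[_ _ /andP[]].
  case: s2 ut st wt add_l add_r => [|z s2] ut st wt add_l add_r.
    case/orP: yw => [|ewy]; first exact: add_r.
    rewrite eq_sym in by1.
    case: (right_end by1 eby ewy) => [|]; last exact: add_r.
    move: wt; rewrite mem_cat mem_rcons !inE !negb_or => /andP[/andP[/negbTE -> _]].
    by move=> /negbTE ->.
  have eyz : e y z.
    move: st; rewrite cat_rcons; case: (s1) => [|c l] /=; first by case/and3P.
    by rewrite cat_path /= => /and3P[_ _ /and3P[]].
  have ub : uniq [:: b; y; z].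
    move: ut; rewrite cat_rcons cat_uniq => /and3P[_ _]; rewrite /= !inE !negb_or.
    by rewrite by1 -!andbA => /and5P[_ -> _ -> _].
  have := inner eby eyz ub yw; move: wt; rewrite mem_cat mem_rcons !inE !negb_or -!andbA.
  by move=> /and5P[/negbTE -> _ /negbTE -> /negbTE -> _].
exists x, s; rewrite -tE; split=> //; first by move: st; rewrite tE.
move=> y; have xt : x \in tval t by rewrite tE mem_head.
case/connectP: (conn x y) => p + ->; elim: p x xt {tE} => //= z p IH x xt /andP[xz].
by apply: IH; apply: closed xt xz.
Qed.

End HamiltonianPath.

Section Enumeration.
Variables (Q : quiver) (R : qa Q -> qv Q -> qv Q -> bool).
Hypothesis R_ends : forall b x y, R b x y -> (qs b == x) && (qt b == y) || (qs b == y) && (qt b == x).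
Hypothesis card_tree : (#|qa Q| + 1 = #|qv Q|)%N.

Lemma path_enumeration x s : uniq (x :: s) ->
  path (fun x y => [exists b, R b x y]) x s -> (forall y, y \in x :: s) ->
  exists m (f : 'I_m.+1 -> qv Q) (g : 'I_m -> qa Q),
    [/\ #|qv Q| = m.+1, bijective f, bijective g &
        forall k, R (g k) (f (widen_ord (leqnSn m) k)) (f (lift ord0 k))].
Proof.
move=> us ps full; pose m := size s.
have cm : #|qv Q| = m.+1.
  by rewrite -[RHS]/(size (x :: s)) -(card_uniqP us); apply: eq_card => y; rewrite full.
pose f (i : 'I_m.+1) := nth x (x :: s) i.
have finj : injective f.
  by move=> i j /eqP; rewrite nth_uniq // => /eqP ij; apply: val_inj.
have [g hg] : exists g : 'I_m -> qa Q, forall k, R (g k) (f (widen_ord (leqnSn m) k)) (f (lift ord0 k)).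
  apply: (fin_all_exists (P := fun k b => R b (f (widen_ord (leqnSn m) k)) (f (lift ord0 k)))) => k.
  by have /existsP[b hb] := pathP x ps k (ltn_ord k); exists b.
have ginj : injective g.
  move=> j k jk; apply: val_inj => /=.
  have := R_ends (hg j); have := R_ends (hg k); rewrite jk => /orP H1 /orP H2.
  have fE u v : f u = f v -> val u = val v by move/finj ->.
  move: H2; case: H1 => /andP[/eqP-> /eqP->] [] /andP[/eqP/fE/= h1 /eqP/fE/= h2];
    by rewrite /bump /= ?add1n in h1 h2; move: h1 h2; lia.
exists m, f, g; split=> //.
  by apply: inj_card_bij => //; rewrite cm card_ord.
apply: inj_card_bij => //; rewrite card_ord.
by move: card_tree; rewrite cm addn1 => -[->].
Qed.

End Enumeration.

Section TreeQuivers.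
Variable Q : quiver.
Hypothesis tree : is_tree_quiver Q.
Hypothesis nonempty : (0 < #|qv Q|)%N.

Lemma linear_enumeration : injective (@qs Q) -> injective (@qt Q) ->
  exists m (f : 'I_m.+1 -> qv Q) (g : 'I_m -> qa Q),
    [/\ #|qv Q| = m.+1, bijective f, bijective g &
        forall k, qs (g k) = f (widen_ord (leqnSn m) k) /\ qt (g k) = f (lift ord0 k)].
Proof.
move=> si ti; case: tree => conn card.
pose R (b : qa Q) x y := (qs b == x) && (qt b == y).
pose e x y := [exists b, R b x y].
have [x [s [us ps fs]]] : exists x s, [/\ uniq (x :: s), path e x s & forall y, y \in x :: s].
  apply: hamiltonian_path nonempty.
  - move=> x y; rewrite (eq_connect (e' := @qadj Q)) // => u v; apply/orP/existsP.
      by case=> /existsP[b hb]; exists b; apply/orP; [left|right].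
    by case=> b /orP[] hb; [left|right]; apply/existsP; exists b.
  - move=> x y z w /existsP[b /andP[/eqP bx /eqP yb]] /existsP[c /andP[/eqP cy /eqP cz]] _.
    case/orP=> /existsP[d /andP[/eqP d1 /eqP d2]]; rewrite !inE.
      by rewrite -d2 -cz (si d c) ?eqxx ?orbT // d1 cy.
    by rewrite -d1 -bx (ti d b) ?eqxx // d2 yb.
  - move=> x y w _ /existsP[b /andP[/eqP bx /eqP yb]] /existsP[d /andP[/eqP d1 /eqP d2]].
    by left; rewrite !inE -d2 -yb (si d b) ?eqxx ?orbT // d1 bx.
  - move=> x y w _ /existsP[b /andP[/eqP bx /eqP yb]] /existsP[d /andP[/eqP d1 /eqP d2]].
    by left; rewrite !inE -d1 -bx (ti d b) ?eqxx ?orbT // d2 yb.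
have RE b u v : R b u v -> (qs b == u) && (qt b == v) || (qs b == v) && (qt b == u).
  by rewrite /R => ->.
have [m [f [g [h1 h2 h3 h4]]]] := path_enumeration RE card us ps fs.
by exists m, f, g; split=> // k; have /andP[/eqP-> /eqP->] := h4 k.
Qed.

(** When all compositions are relations, a vertex with both an incoming and an outgoing arrow has
    just one of each, by gentleness; a source or sink has at most two arrows by the degree bound.
    Hence no vertex has three neighbours. *)
Lemma line_enumeration (r : qa Q -> qa Q -> bool) : gentle r ->
  (forall b c, qt b = qs c -> r b c) ->
  exists m (f : 'I_m.+1 -> qv Q) (g : 'I_m -> qa Q),
    [/\ #|qv Q| = m.+1, bijective f, bijective g &
        forall k, (qs (g k) == f (widen_ord (leqnSn m) k)) && (qt (g k) == f (lift ord0 k)) ||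
                  (qs (g k) == f (lift ord0 k)) && (qt (g k) == f (widen_ord (leqnSn m) k))].
Proof.
move=> [deg2 g1 g2 _ _] rall; case: tree => conn card.
have OO (b b' c : qa Q) : qs b = qt c -> qs b' = qt c -> b = b'.
  move=> h h'; have /card_le1P/(_ b) := g1 c; rewrite !inE h rall // eqxx => /(_ isT b').
  by rewrite !inE h' rall // eqxx => /esym/eqP.
have II (b b' c : qa Q) : qt b = qs c -> qt b' = qs c -> b = b'.
  move=> h h'; have /card_le1P/(_ b) := g2 c; rewrite !inE h rall // eqxx => /(_ isT b').
  by rewrite !inE h' rall // eqxx => /esym/eqP.
have O3 (y : qv Q) b1 b2 b3 : qs b1 = y -> qs b2 = y -> qs b3 = y -> [|| b1 == b2, b2 == b3 | b3 == b1].
  move=> h1 h2 h3; apply/negPn/negP; rewrite !negb_or => /and3P[n1 n2 n3].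
  have [+ _] := deg2 y; rewrite leqNgt => /negP; apply; apply/card_gt2P.
  by exists b1, b2, b3; rewrite !inE h1 h2 h3 eqxx.
have I3 (y : qv Q) b1 b2 b3 : qt b1 = y -> qt b2 = y -> qt b3 = y -> [|| b1 == b2, b2 == b3 | b3 == b1].
  move=> h1 h2 h3; apply/negPn/negP; rewrite !negb_or => /and3P[n1 n2 n3].
  have [_ +] := deg2 y; rewrite leqNgt => /negP; apply; apply/card_gt2P.
  by exists b1, b2, b3; rewrite !inE h1 h2 h3 eqxx.
pose R (b : qa Q) x y := ((qs b == x) && (qt b == y)) || ((qs b == y) && (qt b == x)).
have esym x y : qadj x y = qadj y x :> bool by apply: eq_existsb => b; rewrite orbC.
have [x [s [us ps fs]]] : exists x s, [/\ uniq (x :: s), path (@qadj Q) x s & forall y, y \in x :: s].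
  apply: hamiltonian_path nonempty.
  - by move=> x y; rewrite (eq_connect (e' := @qadj Q)) // => u v; rewrite [X in _ || X]esym orbb.
  - move=> x y z w xy yz uxyz yw; apply/negPn/negP; rewrite !inE !negb_or => /and3P[wx wy wz].
    move: uxyz; rewrite /= !inE negb_or andbT => /andP[/andP[nxy xz] nyz].
    have {}yw : qadj y w by move: yw; rewrite [X in _ || X]esym orbb.
    rewrite esym in xy.
    case/existsP: xy => b1 H1; case/existsP: yz => b2 H2; case/existsP: yw => b3 H3.
    have n12 : b1 != b2.
      by apply: contraTneq H2 => <-; case/orP: H1 => /andP[/eqP-> /eqP->];
         rewrite ?eqxx ?(negbTE xz) ?(negbTE nyz) ?[x == y]eq_sym ?[y == x]eq_sym ?(negbTE nxy) ?andbF //.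
    have n23 : b2 != b3.
      apply: contraTneq H3 => <-; case/orP: H2 => /andP[/eqP-> /eqP->];
         rewrite ?eqxx ?[z == w]eq_sym ?[y == w]eq_sym ?[z == y]eq_sym ?(negbTE wz) ?(negbTE wy) ?(negbTE nyz) ?andbF //.
    have n31 : b3 != b1.
      apply: contraTneq H1 => <-; case/orP: H3 => /andP[/eqP-> /eqP->];
         rewrite ?eqxx ?[y == w]eq_sym ?[y == x]eq_sym ?(negbTE wx) ?(negbTE wy) ?(negbTE nxy) ?andbF //.
    (* Eight orientations of three arrows at [y]: all out or all in contradicts the degree bound,
       and in a mixed case two of them are equal by [OO] or [II]. *)
    case/orP: H1 => /andP[/eqP s1 /eqP t1]; case/orP: H2 => /andP[/eqP s2 /eqP t2];
      case/orP: H3 => /andP[/eqP s3 /eqP t3].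
    + by have := O3 y b1 b2 b3 s1 s2 s3; rewrite (negbTE n12) (negbTE n23) (negbTE n31).
    + by case/eqP: n12; apply: (OO _ _ b3); rewrite t3.
    + by case/eqP: n31; apply: (OO _ _ b2); rewrite t2.
    + by case/eqP: n23; apply: (II _ _ b1); rewrite s1.
    + by case/eqP: n23; apply: (OO _ _ b1); rewrite t1.
    + by case/eqP: n31; apply: (II _ _ b2); rewrite s2.
    + by case/eqP: n12; apply: (II _ _ b3); rewrite s3.
    + by have := I3 y b1 b2 b3 t1 t2 t3; rewrite (negbTE n12) (negbTE n23) (negbTE n31).
  - by move=> x y w _ _; rewrite esym; right.
  - by move=> x y w _ _; rewrite esym; right.
have RE b u v : R b u v -> (qs b == u) && (qt b == v) || (qs b == v) && (qt b == u) by [].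
exact: (@path_enumeration Q R RE card x s us ps fs).
Qed.

End TreeQuivers.

Section QuiverIso.
Variables (K : fieldType) (A : fdalg K) (Q1 Q2 : quiver).
Variables (f : qv Q1 -> qv Q2) (g : qa Q1 -> qa Q2).
Hypothesis f_bij : bijective f.
Hypothesis g_bij : bijective g.
Hypothesis g_s : forall b, qs (g b) = f (qs b).
Hypothesis g_t : forall b, qt (g b) = f (qt b).

Let mp (p : qpath Q1) : qpath Q2 := (f p.1, map g p.2).

Let mp_inj : injective mp.
Proof.
move=> [x s] [y t] [/(bij_inj f_bij)-> /(inj_map (bij_inj g_bij))->] //.
Qed.

Let mp_valid p : valid_path (mp p) = valid_path p.
Proof.
case: p => x s; rewrite /valid_path /=; elim: s x => //= b s IH x.
by rewrite g_s (inj_eq (bij_inj f_bij)) g_t IH.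
Qed.

Let mp_end p : end_vertex (mp p) = f (end_vertex p).
Proof.
case: p => x s; rewrite /end_vertex /=; elim: s x => //= b s IH x.
by rewrite g_t IH.
Qed.

(** If no composable pair is a relation, every path is relation-free, so the kernels on both sides
    are zero. *)
Lemma no_rels_transport (r : qa Q2 -> qa Q2 -> bool) :
  (forall b c, qt b = qs c -> ~~ r b c) ->
  presented_by A (length2_rels (K := K) r) -> presented_by A (@no_rels K Q1).
Proof.
move=> rF /presented_byP[e [a prs]]; apply/presented_byP.
have [h1 h2 h3 h4] := prs; exists (e \o f), (a \o g).
have evE p : eval_path (e \o f) (a \o g) p = eval_path e a (mp p).
  by case: p => x s; rewrite /eval_path /=; elim: s (e (f x)) => //=.
pose mf (F : formal K Q1) : formal K Q2 := [seq (t.1, mp t.2) | t <- F].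
have evfE F : eval_formal (e \o f) (a \o g) F = eval_formal e a (mf F).
  by rewrite /eval_formal big_map; apply: eq_bigr => t _; rewrite evE.
have mfv F : valid_formal (mf F) = valid_formal F.
  by rewrite /valid_formal all_map; apply: eq_all => t /=; rewrite mp_valid.
have mfc F p : coef (mf F) (mp p) = coef F p.
  by rewrite !fcoef_sum big_map; apply: eq_bigr => t _; rewrite (inj_eq mp_inj).
have vrf p : valid_path p -> relfree r p.
  case: p => x s; rewrite /relfree /valid_path /=; elim: s x => //= b [|c s] IH x //=.
  by case/and3P=> _ /eqP bc vs; rewrite rF //=; apply: (IH (qt b)); rewrite /= bc eqxx.
split.
- move=> p q vp vq; rewrite !evE h1 ?mp_valid // mp_end (inj_eq (bij_inj f_bij)).
  by case: ifP => // _; congr eval_path; rewrite /mp /pcat /= map_cat.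
- rewrite -(reindex f (P := predT) (F := e)) //; exact: onW_bij.
- move=> v; have [F [vF <-]] := h3 v; case: f_bij g_bij => f' fK f'K [g' gK g'K].
  exists [seq (t.1, (f' t.2.1, map g' t.2.2)) | t <- F].
  have mfE : mf [seq (t.1, (f' t.2.1, map g' t.2.2)) | t <- F] = F.
    rewrite /mf -map_comp -[RHS]map_id; apply: eq_map => -[c [x s]] /=.
    by rewrite /mp /= f'K (mapK g'K).
  by rewrite -mfv evfE mfE.
- move=> F vF; rewrite evfE; split=> [E|[L [hL hF]]].
    have c0 p : coef F p = 0.
      case vp : (valid_path p); first by rewrite -mfc (evf_indep prs) ?mfv // vrf // mp_valid.
      apply: fcoef_notin => t tF; apply: contraFneq vp => <-; by move/allP: vF; apply.
    by exists [::]; split=> // p; rewrite big_nil c0.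
  case: L hL hF => [|t L] hL hF; last by have [] := hL t (mem_head _ _).
  rewrite (@evf_coef _ _ _ e a _ [::]) => [|q]; first by rewrite /eval_formal big_nil.
  rewrite fcoef_nil; case: f_bij g_bij => f' fK f'K [g' gK g'K].
  have -> : q = mp (f' q.1, map g' q.2) by case: q => x s; rewrite /mp /= f'K (mapK g'K).
  by rewrite mfc hF big_nil.
Qed.

End QuiverIso.

(** * Brauer stars and linear quivers *)

Lemma around_valid (G : bgraph) (v : bV G) i k (p : qpath (brauer_quiver G)) :
  around v i k p -> valid_path p.
Proof.
case: p => j s [/= -> {j}]; rewrite /valid_path /=.
elim: k s i => [|k IH] [|b s] i //= [bE sE]; rewrite /= bE eqxx /=.
apply: IH; rewrite sE -[1%N]addn0 iotaDl -map_comp; apply: eq_map => j /=.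
by rewrite -iterSr.
Qed.

Section StarGraph.
Variables (K : fieldType) (G : bgraph) (c : bV G).
Hypothesis wf : bg_wf G.
Hypothesis inc : forall e, incident c e.
Hypothesis star : injective (fun e : bE G => if end1 e == c then end2 e else end1 e).
Local Notation BQ := (brauer_quiver G).

(** An outer vertex of the star has degree one and carries no arrow. *)
Lemma star_arrow (b : qa BQ) : (val b).1 = c.
Proof.
case: b => -[v i] /=; rewrite /bq_arrow_pred /= => /andP[_]; apply: contraTeq => vc.
rewrite -leqNgt; apply/card_le1_eqP => e e'; rewrite !inE => ve ve'; apply: star.
have H (d : bE G) : incident v d -> (if end1 d == c then end2 d else end1 d) = v.
  move: (inc d); rewrite /incident; case: eqP => [->|_] /=.
    by rewrite eq_sym (negbTE vc) => _ /eqP.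
  by move=> /eqP ->; rewrite [c == v]eq_sym (negbTE vc) orbF => /eqP.
by rewrite /= !H.
Qed.

Lemma star_path_vals (i : bE G) (s : seq (qa BQ)) : valid_from (Q := BQ) i s ->
  [seq val b | b <- s] = [seq (c, iter j (bsucc c) i) | j <- iota 0 (size s)].
Proof.
elim: s i => //= b s IH i /andP[/eqP bi /IH ->].
have bE : val b = (c, i) by rewrite [LHS]surjective_pairing star_arrow bi.
rewrite bE; congr cons; rewrite -[1%N]addn0 iotaDl -map_comp; apply: eq_map => j /=.
by rewrite -iterSr.
Qed.

Lemma star_path_eq (p q : qpath BQ) : valid_path p -> valid_path q ->
  p.1 = q.1 -> size p.2 = size q.2 -> p = q.
Proof.
case: p q => [i s] [j t]; rewrite /valid_path /= => vs vt ij st; congr pair => //.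
by apply: (inj_map val_inj); rewrite (star_path_vals vs) (star_path_vals vt) ij st.
Qed.

Lemma star_inj : injective (@qs BQ) /\ injective (@qt BQ).
Proof.
split=> b b' /= bb'; apply: val_inj; rewrite [LHS]surjective_pairing [RHS]surjective_pairing.
  by rewrite !star_arrow bb'.
move: bb'; rewrite !star_arrow; have [_ _ _ si _] := wf => /si -> //; exact: inc.
Qed.

(** The prefix of length [bdeg c + 1] is the cycle around the centre followed by its first arrow,
    which is a relation. *)
Lemma star_long (p : qpath BQ) : valid_path p -> (bdeg c < size p.2)%N ->
  ideal_fun (@brauer_rels K G) (fun w => (p == w)%:R).
Proof.
case: p => i s; rewrite /valid_path /= => vs ls.
have := vs; rewrite -{1}(cat_take_drop (bdeg c).+1 s) valid_from_cat => /andP[v1 v2].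
have cat_s := cat_take_drop (bdeg c).+1 s.
apply: (ideal_fun_ext _ (ideal_mono (p := (i, [::])) (q := (i, take (bdeg c).+1 s))
   (r := (_, drop (bdeg c).+1 s)) (rho := @brauer_rels K G) _ _ _ _ _)) => //.
- by move=> w; rewrite /pcat /= cat_s.
- exact: v2.
right; left; exists i, c, (i, take (bdeg c).+1 s); split=> //.
  by case: s vs ls v1 v2 cat_s => [|b s] //= _ _ _ _ _; rewrite -(star_arrow b);
     have /andP[] := valP b.
by split=> //=; rewrite (star_path_vals v1) size_takel.
Qed.

End StarGraph.

Section LinearQuiver.
Variable m : nat.
Local Notation L := (linA m.+1).

Lemma linA_end (p : qpath L) : valid_path p -> end_vertex p = (p.1 + size p.2)%N :> nat.
Proof.
case: p => i s; rewrite /valid_path /end_vertex /=; elim: s i => [|b s IH] i /=.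
  by rewrite addn0.
by move=> /andP[/eqP <- /IH ->] /=; rewrite addSnnS.
Qed.

Lemma linA_path_eq (p q : qpath L) : valid_path p -> valid_path q ->
  p.1 = q.1 -> size p.2 = size q.2 -> p = q.
Proof.
case: p q => [i s] [j t]; rewrite /valid_path /= => vs vt ij; move: vt; rewrite -{j}ij.
elim: s t i vs => [|b s IH] [|b' t] i //= /andP[/eqP bi vs] /andP[/eqP bi' vt] [st].
have bb : b = b' by apply: val_inj; exact: etrans bi (esym bi').
by move: vt; rewrite -bb => vt; case: (IH _ _ vs vt st) => ->.
Qed.

Lemma linA_path_exists (i j : 'I_m.+1) : (i <= j)%N ->
  exists p : qpath L, [/\ valid_path p, p.1 = i & end_vertex p = j].
Proof.
move=> ij; have [l jE] : exists l, (j = i + l :> nat)%N by exists (j - i)%N; rewrite subnKC.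
elim: l i jE {ij} => [|l IH] i jE.
  exists (i, [::]); split=> //; by apply: val_inj; rewrite /= jE addn0.
have hi : (i.+1 < m.+1)%N by rewrite (leq_ltn_trans _ (ltn_ord j)) // jE; lia.
have [|[k s] [vs /= kE sE]] := IH (Ordinal hi); first by rewrite jE /= addSnnS.
exists (i, (exist _ i hi : qa L) :: s); split=> //=.
- rewrite /valid_path /= eqxx /=; move: vs; rewrite /valid_path /= kE.
  by congr valid_from; apply: val_inj.
- rewrite -sE /end_vertex kE /=; congr last; exact: val_inj.
Qed.

End LinearQuiver.

(** * Upper triangular matrix units as a model of the linear path algebra *)

Section UpperTriangular.
Variables (K : fieldType) (m : nat).
Local Notation n := m.+1.

Definition tri_pred : pred ('I_n * 'I_n) := fun x => (x.1 <= x.2)%N.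
Definition tri := {x : 'I_n * 'I_n | tri_pred x}.
Definition tri_op (p q : tri) : option tri :=
  if (val p).2 == (val q).1 then insub ((val p).1, (val q).2) else None.
Definition lo (p : tri) : 'I_n := (val p).1.
Definition hi (p : tri) : 'I_n := (val p).2.

Lemma lo_hi p : (lo p <= hi p)%N. Proof. exact: (valP p). Qed.

Lemma tri_eq p q : (p == q) = (lo p == lo q :> nat) && (hi p == hi q :> nat).
Proof. by rewrite -val_eqE -pair_eqE. Qed.

Lemma tri_opE p q s : (tri_op p q == Some s) =
  [&& hi p == lo q :> nat, lo p == lo s :> nat & hi q == hi s :> nat].
Proof.
rewrite /tri_op; have [pq|pq] := eqVneq (val p).2 (val q).1.
  rewrite insubT => [|h]; last first.
    have -> : hi p == lo q :> nat by rewrite /hi pq.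
    exact: tri_eq.
  by rewrite /tri_pred /=; apply: leq_trans (lo_hi p) _; rewrite /hi pq; apply: lo_hi.
by rewrite (_ : (hi p == lo q :> nat) = false) //; apply: negbTE.
Qed.

(** Total on natural numbers so that arcs can be written with plain arithmetic; outside the range
    guarded by [mkE] the value is meaningless. *)
Definition mk (a b : nat) : tri := insubd (exist tri_pred (ord0, ord0) isT) (inord a, inord b).

Lemma mkE a b : (a <= b < n)%N -> lo (mk a b) = a :> nat /\ hi (mk a b) = b :> nat.
Proof.
move=> /andP[ab bn]; have an : (a < n)%N by apply: leq_ltn_trans bn.
by rewrite /lo /hi /mk val_insubd /tri_pred /= !inordK // ab /= !inordK.
Qed.

Lemma linA_tri_iso (A : fdalg K) :
  presented_by A (@no_rels K (linA n)) -> alg_iso (monalg K tri_op) A.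
Proof.
move=> /presented_byP[e [a [h1 h2 h3 h4]]].
(* Having no relations is the quadratic monomial case with an empty relation, so [monalg_iso]
   applies. *)
have prs : presentation (length2_rels (fun _ _ => false)) e a.
  split=> // f vf; rewrite h4 //; split=> -[[|t M] [hM hf]].
  - by exists [::].
  - by have [] := hM t (mem_head _ _).
  - by exists [::].
  - by have [_ _ [b [b' []]]] := hM t (mem_head _ _).
have [N hN] : exists N : tri -> qpath (linA n), forall p,
    [/\ valid_path (N p), (N p).1 = lo p & end_vertex (N p) = hi p].
  exact: fin_all_exists (fun p => linA_path_exists (lo_hi p)).
have szN p : (size (N p).2 = hi p - lo p)%N.
  have [v1 v2 v3] := hN p; have := linA_end v1; rewrite v2 v3; lia.
have rf p : relfree (fun _ _ : qa (linA n) => false) p.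
  case: p => i s; rewrite /relfree /=; case: s => //= b s.
  by elim: s b => //= b s IH _; apply: IH.
apply: (monalg_iso prs (N := N)) => [p q pq|p|p q].
- have [_ p1 p2] := hN p; have [_ q1 q2] := hN q; apply/eqP.
  by rewrite tri_eq -p1 -q1 -p2 -q2 pq !eqxx.
- rewrite rf andbT; split=> [vp|[k ->]]; last by have [] := hN k.
  have pe := linA_end vp; have ple := ltn_ord (end_vertex p).
  have [|l1 l2] := @mkE p.1 (end_vertex p); first by rewrite ple andbT pe leq_addr.
  exists (mk p.1 (end_vertex p)); have [v1 v2 v3] := hN (mk p.1 (end_vertex p)).
  apply: linA_path_eq => //; first by rewrite v2; apply: val_inj.
  by rewrite szN l1 l2 pe addKn.
- have [p1 p2 p3] := hN p; have [q1 q2 q3] := hN q.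
  case E : (tri_op p q) => [s|].
    have /eqP := E; rewrite tri_opE => /and3P[/eqP pq /eqP sl /eqP sh].
    have pq' : end_vertex (N p) = (N q).1 by rewrite p3 q2; apply: val_inj.
    split=> //; have [s1 s2 s3] := hN s; apply: linA_path_eq => //.
    + exact: valid_pcat.
    + by rewrite s2 /= p2; apply: val_inj; rewrite /= sl.
    + rewrite size_cat !szN -sl -sh; have := lo_hi p; have := lo_hi q; lia.
  left; rewrite p3 q2; apply/negP => /eqP pq; move: E.
  have /eqP -> // : tri_op p q == Some (mk (lo p) (hi q)).
  have [|l1 l2] := @mkE (lo p) (hi q).
    by rewrite ltn_ord andbT (leq_trans (lo_hi p)) // pq lo_hi.
  by rewrite tri_opE l1 l2 pq !eqxx.
Qed.

End UpperTriangular.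

Section StarAlgebra.
Variables (K : fieldType) (m : nat).
(** At least two edges: the Brauer quiver of a single edge has no arrow, so its algebra is [K],
    while the trivial extension of [K] has dimension two. *)
Hypothesis m_gt0 : (0 < m)%N.
Local Notation n := m.+1.
Local Notation T := (triv_ext (monalg K (@tri_op m))).
Local Notation td := (@dvec K T).
Local Notation B := (tri m + tri m)%type.

Definition star_graph : bgraph :=
  @BGraph (option 'I_n) 'I_n (fun=> None) Some (fun v i => if v is None then ordS i else i).
Local Notation BQ := (brauer_quiver star_graph).

Lemma star_incident (i : 'I_n) : incident (None : bV star_graph) (i : bE star_graph).
Proof. by rewrite /incident eqxx. Qed.

Lemma star_deg : bdeg (None : bV star_graph) = n.
Proof.
rewrite /bdeg -[RHS]card_ord; apply: eq_card => i; rewrite !inE; exact: star_incident.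
Qed.

Lemma iter_ordS j (i : 'I_n) : iter j (@ordS n) i = ((i + j) %% n)%N :> nat.
Proof.
elim: j => [|j IH]; first by rewrite addn0 modn_small.
by rewrite iterS /= IH -addn1 modnDml addn1 addnS.
Qed.

Lemma star_wf : bg_wf star_graph.
Proof.
have c0 (v : bV star_graph) : connect (@badj star_graph) None v.
  case: v => [i|]; last exact: connect0.
  by apply: connect1; apply/existsP; exists i; rewrite /= !eqxx.
have c1 (v : bV star_graph) : connect (@badj star_graph) v None.
  case: v => [i|]; last exact: connect0.
  by apply: connect1; apply/existsP; exists i; rewrite /= !eqxx ?orbT.
split.
- by [].
- by move=> u v; apply: connect_trans (c1 u) (c0 v).
- by case=> [i|] j //= _; apply: star_incident.
- case=> [i|] j k; last by move=> _ _ /= /(can_inj (@ordSK n)).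
  by rewrite /incident.
- case=> [i|] j k.
    by rewrite /incident /= => /eqP[->] /eqP[->]; exists 0%N.
  move=> _ _; exists (n - j + k)%N; apply: val_inj => /=.
  rewrite iter_ordS addnA subnKC; last exact: ltnW.
  by rewrite modnDl modn_small.
Qed.

Lemma star_is_star : is_star star_graph.
Proof. by exists None; split=> [i|i j /= []]; first exact: star_incident. Qed.

(** The dual of a path from [lo p] to [hi p] runs from [hi p] to [lo p]; together the two make one
    full turn of [n] arrows. *)
Definition tsrc (k : B) : 'I_n := match k with inl p => lo p | inr p => hi p end.
Definition ttgt (k : B) : 'I_n := match k with inl p => hi p | inr p => lo p end.
Definition tlen (k : B) : nat :=
  match k with inl p => hi p - lo p | inr p => n - (hi p - lo p) end%N.

(* The vectors of the dual basis complete the paths of the linear quiver to the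
   paths of length at most n in the oriented cycle: [arc i l] starts at [i] and has
   length [l]. *)
Definition arc (i l : nat) : B :=
  if (i + l < n)%N then inl (mk m i (i + l)) else inr (mk m (i + l - n) i).

Lemma arcK k : arc (tsrc k) (tlen k) = k.
Proof.
case: k => p; have pl := lo_hi p; have hp := ltn_ord (hi p); rewrite /arc /=.
  rewrite subnKC // hp; congr inl; apply/eqP; rewrite tri_eq.
  by have [|-> ->] := @mkE m (lo p) (hi p); rewrite ?pl ?hp ?eqxx.
have -> : (hi p + (n - (hi p - lo p)) < n)%N = false by lia.
have -> : (hi p + (n - (hi p - lo p)) - n = lo p)%N by lia.
congr inr; apply/eqP; rewrite tri_eq.
by have [|-> ->] := @mkE m (lo p) (hi p); rewrite ?pl ?hp ?eqxx.
Qed.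

Lemma tsrc_arc (i : 'I_n) l : (l <= n)%N -> tsrc (arc i l) = i.
Proof.
move=> ln; have hi := ltn_ord i; apply: val_inj; rewrite /arc; case: ifP => il /=.
  by have [|-> _] := @mkE m i (i + l); rewrite ?leq_addr.
by have [|_ ->] := @mkE m (i + l - n) i; lia.
Qed.

Lemma tlen_arc (i : 'I_n) l : (l <= n)%N -> tlen (arc i l) = l.
Proof.
move=> ln; have hi := ltn_ord i; rewrite /arc; case: ifP => il /=.
  by have [|-> ->] := @mkE m i (i + l); rewrite ?leq_addr //; lia.
by have [|-> ->] := @mkE m (i + l - n) i; lia.
Qed.

Lemma tlen_le k : (tlen k <= n)%N.
Proof. by case: k => p /=; have := ltn_ord (hi p); lia. Qed.

Lemma te_tri_E (x y k : B) : te_op (@tri_op m) x y k =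
  match x, y, k with
  | inl p, inl q, inl s => [&& hi p == lo q :> nat, lo p == lo s :> nat & hi q == hi s :> nat]
  | inl p, inr q, inr s => [&& hi s == lo p :> nat, lo s == lo q :> nat & hi p == hi q :> nat]
  | inr q, inl p, inr s => [&& hi p == lo s :> nat, lo p == lo q :> nat & hi s == hi q :> nat]
  | _, _, _ => false
  end.
Proof. by case: x y k => [p|p] [q|q] [s|s] //=; rewrite tri_opE. Qed.

Lemma te_eqE (k z : B) : (k == z) =
  match k, z with
  | inl p, inl q | inr p, inr q => (lo p == lo q :> nat) && (hi p == hi q :> nat)
  | _, _ => false
  end.
Proof. by case: k z => [p|p] [q|q] //; rewrite -tri_eq. Qed.

(** The arrow [arc k 1] belongs to the linear quiver unless [k] is the last vertex, when it is the
    dual of the longest path. An arc of length [n] is the dual of an idempotent, hence in the socle,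
    and is killed by every arrow. *)
Lemma arc_mul (i k : 'I_n) l : (l <= n)%N -> k = ((i + l) %% n)%N :> nat ->
  vmul (td (arc i l)) (td (arc k 1)) = if (l < n)%N then td (arc i l.+1) else 0.
Proof.
move=> ln kE; have hi := ltn_ord i; have hk := ltn_ord k.
(* As [i < n] and [l <= n], the sum wraps around at most once, so the remainder becomes a
   subtraction. *)
have {}kE : (if (i + l < n)%N then k = (i + l)%N :> nat else if (i + l < n + n)%N then k = (i + l - n)%N :> nat
   else False).
  case: ifP => il; first by rewrite kE modn_small.
  have -> : (i + l < n + n)%N by lia.
  rewrite kE -[in LHS](subnK (m := n) (n := i + l)) ?modnDr ?modn_small //; lia.
case: (ltnP l n) => ln'.
  apply: te_mul => z; rewrite te_tri_E te_eqE /arc.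
  case: ltnP kE => il kE.
    have [|l1 l2] := @mkE m i (i + l); first by rewrite leq_addr.
    case: (ltnP (k + 1)) => k1; last first.
      have -> : (i + l.+1 < n)%N = false by lia.
      have [|l3 l4] := @mkE m (k + 1 - n) k; first by lia.
      have [|l5 l6] := @mkE m (i + l.+1 - n) i; first by lia.
      by case: z => p //; have := lo_hi p; rewrite l1 l2 l3 l4 l5 l6; lia.
    have -> : (i + l.+1 < n)%N by lia.
    have [|l3 l4] := @mkE m k (k + 1); first by rewrite leq_addr.
    have [|l5 l6] := @mkE m i (i + l.+1); first by lia.
    by case: z => p //; have := lo_hi p; rewrite l1 l2 l3 l4 l5 l6; lia.
  have [|l1 l2] := @mkE m (i + l - n) i; first by lia.
  have k1 : (k + 1 < n)%N by case: ifP kE; lia.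
  rewrite k1; have -> : (i + l.+1 < n)%N = false by lia.
  have [|l3 l4] := @mkE m k (k + 1); first by rewrite leq_addr.
  have [|l5 l6] := @mkE m (i + l.+1 - n) i; first by lia.
  have kE' : k = (i + l - n)%N :> nat by case: ifP kE.
  by case: z => p //; have := lo_hi p; rewrite l1 l2 l3 l4 l5 l6; lia.
apply: te_mul0 => z; rewrite te_tri_E /arc.
have -> : (i + l < n)%N = false by lia.
have kE' : k = (i + l - n)%N :> nat by move: kE; do ?case: ifP => //; lia.
have [|l1 l2] := @mkE m (i + l - n) i; first by lia.
case: ltnP => k1 //; have [|l3 l4] := @mkE m k (k + 1); first by rewrite leq_addr.
by case: z => p //; have := lo_hi p; rewrite l1 l2 l3 l4; lia.
Qed.

Let mkii (i : 'I_n) : lo (mk m i i) = i :> nat /\ hi (mk m i i) = i :> nat.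
Proof. by apply: mkE; rewrite leqnn ltn_ord. Qed.

Lemma tri_idem_l (i : 'I_n) k :
  vmul (td (inl (mk m i i))) (td k) = if i == tsrc k then td k else 0.
Proof.
have [l1 l2] := mkii i.
have -> : (i == tsrc k) = (i == tsrc k :> nat) by [].
case: eqP => ik; [apply: te_mul|apply: te_mul0] => z; rewrite te_tri_E ?te_eqE;
  by case: k z ik => [p|p] [q|q] //=; rewrite l1 l2; lia.
Qed.

Lemma tri_idem_r (i : 'I_n) k :
  vmul (td k) (td (inl (mk m i i))) = if i == ttgt k then td k else 0.
Proof.
have [l1 l2] := mkii i.
have -> : (i == ttgt k) = (i == ttgt k :> nat) by [].
case: eqP => ik; [apply: te_mul|apply: te_mul0] => z; rewrite te_tri_E ?te_eqE;
  by case: k z ik => [p|p] [q|q] //=; rewrite l1 l2; lia.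
Qed.

Lemma ttgt_arc1 (i : 'I_n) : ttgt (arc i 1) = ordS i.
Proof.
have hi := ltn_ord i; apply: val_inj; rewrite /arc /= addn1; case: ltnP => il /=.
  by have [|_ ->] := @mkE m i i.+1; [lia|rewrite modn_small].
have [|-> _] := @mkE m (i.+1 - n) i; first by lia.
by have -> : i.+1 = n by [lia]; rewrite modnn subnn.
Qed.

Lemma star_triv_ext_presentation : associative (@vmul K (monalg K (@tri_op m))) ->
  presented_by T (@brauer_rels K star_graph).
Proof.
move=> vA; apply/presented_byP.
pose e (i : qv BQ) : vec T := td (inl (mk m i i)).
pose a (b : qa BQ) : vec T := td (arc (val b).2 1).
have inc : forall i : bE star_graph, incident (None : bV star_graph) i := star_incident.
have st : injective (fun d : bE star_graph => if end1 d == None then end2 d else end1 d).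
  by move=> i j [].
have arrP (i : 'I_n) : bq_arrow_pred ((None, i) : bV star_graph * bE star_graph).
  by rewrite /bq_arrow_pred star_incident star_deg.
pose pth (i : 'I_n) l : qpath BQ :=
  (i, [seq (exist (@bq_arrow_pred star_graph) (None, iter j (@ordS n) i) (arrP _) : qa BQ)
     | j <- iota 0 l]).
have pthV i l : valid_path (pth i l).
  apply: (@around_valid star_graph None i l); split=> //=; rewrite -map_comp; exact: eq_map.
have evE (p : qpath BQ) : valid_path p -> eval_path e a p =
    if (size p.2 <= n)%N then td (arc p.1 (size p.2)) else 0.
  case: p => i s; elim/last_ind: s => [|s b IH] vp /=.
    by rewrite /eval_path /e /arc /= addn0 ltn_ord.
  have vs := star_path_vals inc st vp.
  move: vp; rewrite /valid_path /= -cats1 valid_from_cat => /andP[vp _].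
  rewrite /eval_path /= foldl_cat /= -[foldl _ _ _]/(eval_path e a (i, s)) IH //= cats1 size_rcons.
  case sn: (size s <= n)%N; last first.
    by rewrite vmul0l; case: ifP => // /ltnW; rewrite sn.
  apply: arc_mul => //.
  move: vs; rewrite map_rcons size_rcons -(addn1 (size s)) iotaD map_cat /= cats1 => /rcons_inj[_ ->] /=.
  exact: iter_ordS.
pose N (k : fd_basis T) := pth (tsrc k) (tlen k).
have szN k : size (N k).2 = tlen k by rewrite size_map size_iota.
exists e, a; apply: (@std_presentation K T BQ _ e a _ _ _ _ _ N).
- exact: triv_ext_assoc.
- move=> i j; rewrite /e tri_idem_l [tsrc _]/=.
  have -> : lo (mk m j j) = j by apply: val_inj; case: (mkii j).
  by case: eqP => [->|].
- move=> b; rewrite /e /a tri_idem_r ttgt_arc1 /=.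
  have bn : (val b).1 = None := star_arrow inc st b.
  by rewrite bn eqxx.
- exact: (unit_basis tri_idem_l tri_idem_r).
(* Only the centre has degree above one, so there are neither two cycles at an edge nor arrows
   around different vertices; the remaining relations are paths of length [n + 1]. *)
- move=> g [|[]].
  + case=> i [v [v' [p [q [vv' _ /andP[dv dv'] _ _]]]]].
    have H w : (1 < bdeg (w : bV star_graph))%N -> w = None.
      case: w => // j; rewrite ltnNge => /negP[]; apply/card_le1_eqP => x y.
      by rewrite !inE /incident /= => /eqP[->] /eqP[->].
    by move: vv'; rewrite (H _ dv) (H _ dv').
  + case=> i [v [p [_ dv pv ->]]]; have vp := around_valid pv.
    rewrite /valid_formal /= vp evf1 vscale1 evE //; split=> //.
    have [_ /(congr1 size)] := pv; rewrite !size_map size_iota => ->.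
    case: v dv {pv} => [j|_]; last by rewrite star_deg ltnn.
    rewrite ltnNge => /negP[]; apply/card_le1_eqP => x y.
    by rewrite !inE /incident /= => /eqP[->] /eqP[->].
  + by case=> b [b' [_ + _]]; rewrite (star_arrow inc st b) (star_arrow inc st b').
- by move=> k; apply: pthV.
- by move=> k; rewrite evE ?szN ?tlen_le ?arcK //; apply: pthV.
(* A path in the oriented cycle is determined by its start and length, so up to length [n] it is its
   own normal form. *)
move=> p vp; case: (leqP (size p.2) n) => pn; [right|left].
  exists (arc p.1 (size p.2)); rewrite (star_path_eq inc st (pthV _ _) vp (p := N _)).
  - by apply: ideal_fun_ext (ideal_fun0 _) => w; rewrite subrr.
  - by rewrite /= tsrc_arc.
  - by rewrite szN tlen_arc.
by apply: (star_long K inc st) => //; rewrite star_deg.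
Qed.

End StarAlgebra.

(** * Brauer lines *)

Lemma line_deg (G : bgraph) (v : bV G) : is_line G -> (bdeg v <= 2)%N.
Proof.
move=> [m [vt [ed [vbij ebij ends]]]]; case: (vbij) => vt' vtK vtK'; case: ebij => ed' edK edK'.
have H e : incident v e -> (vt' v = ed' e :> nat) \/ (vt' v = (ed' e).+1 :> nat).
  move=> ve; have : v \in [set end1 e; end2 e].
    by move: ve; rewrite !inE /incident ![_ == v]eq_sym.
  rewrite -{1 2}[e]edK' ends !inE => /orP[] /eqP ->; rewrite vtK /=; first by left.
  by right; rewrite /bump /= add1n.
rewrite leqNgt; apply/negP => /card_gt2P[x [y [z [[]]]]]; rewrite !inE => /H hx /H hy /H hz [xy yz zx].
have nE (a b : bE G) : a != b -> ed' a != ed' b :> nat.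
  by apply: contraNneq => h; apply/eqP; rewrite -[a]edK' -[b]edK'; congr ed; apply: val_inj.
by move: (nE _ _ xy) (nE _ _ yz) (nE _ _ zx) => /eqP ? /eqP ? /eqP ?; lia.
Qed.

(** Among three consecutive arrows either two neighbours turn around different vertices, a zero
    relation, or all three turn around one vertex of degree two, which gives a cycle followed by its
    first arrow. *)
Lemma line_long (K : fieldType) (G : bgraph) (p : qpath (brauer_quiver G)) :
  is_line G -> valid_path p -> (2 < size p.2)%N ->
  ideal_fun (@brauer_rels K G) (fun w => (p == w)%:R).
Proof.
move=> line; case: p => i [|b1 [|b2 [|b3 s]]] //= vp _.
have vp' := vp; move: vp'; rewrite /valid_path => /and4P[/eqP s1 /eqP s2 /eqP s3 vs].
have [v12|v12] := eqVneq (val b1).1 (val b2).1; last first.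
  apply: (ideal_fun_ext _ (ideal_mono (p := (i, [::])) (q := (qs b1, [:: b1; b2]))
    (r := (qs b3, b3 :: s)) (rho := @brauer_rels K G) _ _ _ _ _)) => //.
  - by rewrite /valid_path /= eqxx.
  - by right; right; exists b1, b2; split.
have [v23|v23] := eqVneq (val b2).1 (val b3).1; last first.
  apply: (ideal_fun_ext _ (ideal_mono (p := (i, [:: b1])) (q := (qs b2, [:: b2; b3]))
    (r := (qt b3, s)) (rho := @brauer_rels K G) _ _ _ _ _)) => //.
  - by rewrite /valid_path /= andbT; apply/eqP.
  - by right; right; exists b2, b3; split.
apply: (ideal_fun_ext _ (ideal_mono (p := (i, [::])) (q := (i, [:: b1; b2; b3]))
    (r := (qt b3, s)) (rho := @brauer_rels K G) _ _ _ _ _)) => //.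
right; left; exists i, (val b1).1, (i, [:: b1; b2; b3]).
have /andP[i1 d1] := valP b1.
have d2 : bdeg (val b1).1 = 2%N by apply/eqP; rewrite eqn_leq d1 line_deg.
split=> //; first by move: s1 => /= <-.
rewrite d2; split=> //=.
rewrite [val b1]surjective_pairing [val b2]surjective_pairing [val b3]surjective_pairing /=.
by move: s1 s2 s3 => /= s1 s2 s3; rewrite -v23 -v12 s3 -v12 s2 s1.
Qed.

Section LineOp.
Variables (K : fieldType) (m : nat) (dir : 'I_m -> bool).

(* The k-th edge points from k to k+1 if [dir k], and from k+1 to k otherwise. *)
Definition pt (k : 'I_m) (b : bool) : 'I_m.+1 := if b then widen_ord (leqnSn m) k else lift ord0 k.

Lemma ptE k b : pt k b = (if b then k : nat else k.+1) :> nat.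
Proof. by case: b. Qed.

Lemma pt_inj k : injective (pt k).
Proof. by move=> b c /(congr1 val) /=; rewrite !ptE; case: b c => [] [] //; lia. Qed.

Definition line_op (x y : 'I_m.+1 + 'I_m) : option ('I_m.+1 + 'I_m) :=
  match x, y with
  | inl i, inl j => if i == j then Some (inl i) else None
  | inl i, inr k => if i == pt k (dir k) then Some (inr k) else None
  | inr k, inl i => if i == pt k (~~ dir k) then Some (inr k) else None
  | inr _, inr _ => None
  end.

Lemma line_iso (A : fdalg K) (Q : quiver) (r : qa Q -> qa Q -> bool)
    (f : 'I_m.+1 -> qv Q) (g : 'I_m -> qa Q) :
  presented_by A (length2_rels (K := K) r) ->
  (forall b c, qt b = qs c -> r b c) -> bijective f -> bijective g ->
  (forall k, qs (g k) = f (pt k (dir k)) /\ qt (g k) = f (pt k (~~ dir k))) ->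
  alg_iso (monalg K line_op) A.
Proof.
move=> /presented_byP[e [a prs]] rall fb gb gE.
have fI := bij_inj fb; have gI := bij_inj gb.
pose N (x : 'I_m.+1 + 'I_m) : qpath Q :=
  match x with inl i => (f i, [::]) | inr k => (qs (g k), [:: g k]) end.
have vN x : valid_path (N x) by case: x => [i|k] //=; apply: valid_arrow.
apply: (monalg_iso prs (N := N)) => [[i|k] [j|l] //= []|p|].
- by move/fI ->.
- by move=> _ /gI ->.
- split=> [|[k ->]]; last by rewrite vN /relfree; case: k.
  case: fb gb => f' fK f'K [g' gK g'K].
  case: p => i [|b [|c s]] /andP[vp rp].
  + by exists (inl (f' i)); rewrite /= f'K.
  + exists (inr (g' b)); rewrite /= g'K; congr pair.
    by move: vp; rewrite /valid_path /= andbT => /eqP.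
  + move: vp rp; rewrite /valid_path /relfree /= => /and3P[_ /eqP bc _].
    by rewrite rall.
have nrf k l : qt (g k) = qs (g l) -> ~~ relfree r (pcat (N (inr k)) (N (inr l))).
  by move=> kl; rewrite /relfree /= rall.
move=> [i|k] [j|l] /=; rewrite ?/end_vertex /=.
- by case: eqP => [->|ij]; [|left; apply/eqP => /fI].
- have [-> _] := gE l; case: eqP => [->|il]; [|by left; apply/eqP => /fI].
  by rewrite /pcat /= (gE l).1.
- have [_ kt] := gE k; rewrite kt; case: eqP => [->|jk]; first by rewrite /pcat.
  by left; apply/eqP => /fI /esym.
- by have [kl|/eqP kl] := eqVneq (qt (g k)) (qs (g l)); [right; apply: nrf|left; apply/eqP].
Qed.

End LineOp.

(** * The trivial extension of a line with radical square zero *)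

Section LineAlgebra.
Variables (K : fieldType) (m' : nat).
Local Notation m := m'.+1.
Local Notation n := m'.+2.
Variable dir : 'I_m -> bool.
Local Notation P := ('I_n + 'I_m)%type.
Local Notation T := (triv_ext (monalg K (line_op dir))).
Local Notation td := (@dvec K T).

(** Edge [x] joins the vertices [x] and [x + 1], so [v] meets the edges [v - 1] and [v] and
    exchanges them. At the two ends the truncated predecessor and the guard [v < n] leave the only
    edge fixed. *)
Definition line_succ (v : 'I_n.+1) (x : 'I_n) : 'I_n :=
  if v == x :> nat then inord v.-1 else if (v < n)%N then inord v else x.

Definition line_graph : bgraph :=
  @BGraph 'I_n.+1 'I_n (widen_ord (leqnSn n)) (lift ord0) line_succ.
Local Notation BQ := (brauer_quiver line_graph).

Lemma line_incident (v : bV line_graph) (x : bE line_graph) :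
  incident v x = (v == x :> nat) || (v == x.+1 :> nat).
Proof.
rewrite /incident -!val_eqE /= /bump /= add1n; by rewrite ![_ == nat_of_ord v]eq_sym.
Qed.

Lemma line_succE (v : bV line_graph) (x : bE line_graph) : incident v x ->
  bsucc v x = (if v == x :> nat then v.-1 else if (v < n)%N then v : nat else x) :> nat.
Proof.
rewrite line_incident /= /line_succ => vx; have hv := ltn_ord v; have hx := ltn_ord x.
by case: eqP => [E|_]; [rewrite inordK // E; lia|case: ltnP => // ?; rewrite inordK].
Qed.

Lemma line_is_line : is_line line_graph.
Proof. by exists n, id, id; split=> //; exists id. Qed.

Lemma line_deg_gt1 (v : bV line_graph) : (1 < bdeg v)%N = (0 < v < n)%N.
Proof.
have hv := ltn_ord v; apply/card_gt1P/idP.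
  move=> [x [y [+ + xy]]]; rewrite !inE !line_incident.
  have := ltn_ord x; have := ltn_ord y; move: xy; rewrite -val_eqE /=; lia.
move=> hv2; exists (inord v : 'I_n), (inord v.-1 : 'I_n).
by rewrite !inE !line_incident -val_eqE /= !inordK; try split; lia.
Qed.

Lemma line_wf : bg_wf line_graph.
Proof.
split.
- by move=> x; rewrite -val_eqE /= /bump /= add1n; lia.
- have c0 k (hk : (k < n.+1)%N) : connect (@badj line_graph) ord0 (Ordinal hk) /\
      connect (@badj line_graph) (Ordinal hk) ord0.
    elim: k hk => [|k IH] hk.
      by rewrite (_ : Ordinal hk = ord0) ?connect0 //; apply: val_inj.
    have [h1 h2] := IH (ltnW hk); have hk' : (k < n)%N by [].
    split; [apply: connect_trans h1 _|apply: connect_trans _ h2];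
      apply: connect1; apply/existsP; exists (Ordinal hk');
      by rewrite -!val_eqE /= /bump /= !add1n !eqxx ?orbT.
  by move=> [u hu] [v hv]; apply: connect_trans (c0 u hu).2 (c0 v hv).1.
- move=> v x vx; rewrite line_incident line_succE //; move: vx; rewrite line_incident.
  have := ltn_ord x; have := ltn_ord v; move: (nat_of_ord v) (nat_of_ord x) => i j.
  by case: (eqVneq i j); case: (ltnP i n) => /=; lia.
- move=> v x y vx vy /(congr1 val) /=.
  rewrite -[val _]/(nat_of_ord (bsucc v x)) -[RHS]/(nat_of_ord (bsucc v y)) !line_succE //.
  move: vx vy; rewrite !line_incident => vx vy E; apply: val_inj => /=.
  have := ltn_ord x; have := ltn_ord v; have := ltn_ord y; move: vx vy E.
  move: (nat_of_ord v) (nat_of_ord x) (nat_of_ord y) => i j k.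
  by case: (eqVneq i j); case: (eqVneq i k); case: (ltnP i n) => /=; lia.
- move=> v x y vx vy; have [->|xy] := eqVneq x y; first by exists 0%N.
  exists 1%N; apply: val_inj; rewrite /= -[LHS]/(nat_of_ord (bsucc v x)) line_succE //.
  move: vx vy xy; rewrite !line_incident -val_eqE /= => vx vy xy.
  have := ltn_ord x; have := ltn_ord v; have := ltn_ord y; move: vx vy xy.
  move: (nat_of_ord v) (nat_of_ord x) (nat_of_ord y) => i j k.
  by case: (eqVneq i j); case: (ltnP i n) => /=; lia.
Qed.

Lemma arr_subproof (k : 'I_m) b :
  bq_arrow_pred ((inord k.+1, pt k b) : bV line_graph * bE line_graph).
Proof.
have hk := ltn_ord k; rewrite /bq_arrow_pred line_deg_gt1 line_incident /= inordK ?ptE; last by lia.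
by case: b; lia.
Qed.
(** The inner vertex [k + 1] carries two opposite arrows between the edges [k] and [k + 1]; [true]
    selects the one starting at [k]. The maps [akey] and [aside] recover the two labels. *)
Definition arr (k : 'I_m) b : qa BQ := exist (@bq_arrow_pred line_graph) _ (arr_subproof k b).
Definition akey (x : qa BQ) : 'I_m := inord (val x).1.-1.
Definition aside (x : qa BQ) : bool := (val x).2 == (val x).1.-1 :> nat.

Lemma arrK x : arr (akey x) (aside x) = x.
Proof.
case: x => -[v y] vy; apply: val_inj; rewrite /= /akey /aside /=.
move: vy; rewrite /bq_arrow_pred /= line_deg_gt1 line_incident => vy.
have hv := ltn_ord v; have hy := ltn_ord y.
have E : (inord v.-1 : 'I_m) = v.-1 :> nat by rewrite inordK; lia.
congr pair; apply: val_inj; rewrite /= ?ptE ?E; last by case: eqP; lia.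
by rewrite inordK; lia.
Qed.

Lemma akeyK k b : akey (arr k b) = k.
Proof.
have hk := ltn_ord k; have E : (inord k.+1 : 'I_n.+1) = k.+1 :> nat by rewrite inordK //; lia.
by apply: val_inj; rewrite /akey /= E inordK.
Qed.
Lemma asideK k b : aside (arr k b) = b.
Proof.
have hk := ltn_ord k; rewrite /aside -[(val _).2]/(pt k b) ptE.
by rewrite -[(val _).1]/(inord k.+1 : 'I_n.+1) inordK; case: b; lia.
Qed.

Lemma qs_arr k b : qs (arr k b) = pt k b. Proof. by []. Qed.
Lemma qt_arr k b : qt (arr k b) = pt k (~~ b).
Proof.
apply: val_inj; have hk := ltn_ord k; have /andP[inc _] := arr_subproof k b.
rewrite -[LHS]/(nat_of_ord (bsucc (inord k.+1 : bV line_graph) (pt k b : bE line_graph))).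
rewrite -[RHS]/(nat_of_ord (pt k (~~ b))).
have E : (inord k.+1 : 'I_n.+1) = k.+1 :> nat by rewrite inordK //; lia.
rewrite (line_succE inc) E !ptE.
by case: (b) => /=; rewrite ?eqxx // gtn_eqF // ltnS hk.
Qed.

Definition bsrc (x : P + P) : 'I_n :=
  match x with
  | inl (inl i) | inr (inl i) => i
  | inl (inr k) => pt k (dir k)
  | inr (inr k) => pt k (~~ dir k)
  end.
Definition btgt (x : P + P) : 'I_n :=
  match x with
  | inl (inl i) | inr (inl i) => i
  | inl (inr k) => pt k (~~ dir k)
  | inr (inr k) => pt k (dir k)
  end.

Lemma te_line_E (x y z : P + P) : te_op (line_op dir) x y z =
  match x, y, z with
  | inl (inl i), inl (inl j), inl (inl l) => (i == j) && (i == l)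
  | inl (inl i), inl (inr k), inl (inr l) => (i == pt k (dir k)) && (k == l)
  | inl (inr k), inl (inl i), inl (inr l) => (i == pt k (~~ dir k)) && (k == l)
  | inl (inl i), inr (inl j), inr (inl l) => (l == i) && (l == j)
  | inl (inl i), inr (inr k), inr (inr l) => (i == pt l (~~ dir l)) && (l == k)
  | inl (inr k), inr (inr l), inr (inl i) => (i == pt k (dir k)) && (k == l)
  | inr (inl j), inl (inl i), inr (inl l) => (i == l) && (i == j)
  | inr (inr k), inl (inl i), inr (inr l) => (i == pt l (dir l)) && (l == k)
  | inr (inr l), inl (inr k), inr (inl i) => (i == pt k (~~ dir k)) && (k == l)
  | _, _, _ => false
  end.
Proof.
by case: x y z => [[i|i]|[i|i]] [[j|j]|[j|j]] [[l|l]|[l|l]] //=; case: ifP.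
Qed.

Lemma line_idem_l i x :
  vmul (td (inl (inl i))) (td x) = if i == bsrc x then td x else 0.
Proof.
case: x => [[j|k]|[j|k]] /=; case: eqP => h; first [apply: te_mul0 => z|apply: te_mul => z];
  rewrite te_line_E; case: z => [[j'|k']|[j'|k']] //=;
  rewrite -?[inl _ == inl _]/(_ == _) -?[inr _ == inr _]/(_ == _); do ?case: eqP => //= ?; congruence.
Qed.

Lemma line_idem_r i x :
  vmul (td x) (td (inl (inl i))) = if i == btgt x then td x else 0.
Proof.
case: x => [[j|k]|[j|k]] /=; case: eqP => h; first [apply: te_mul0 => z|apply: te_mul => z];
  rewrite te_line_E; case: z => [[j'|k']|[j'|k']] //=;
  rewrite -?[inl _ == inl _]/(_ == _) -?[inr _ == inr _]/(_ == _); do ?case: eqP => //= ?; congruence.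
Qed.

(** Of the two opposite arrows with key [k], the one pointing along [dir k] is the arrow of [A] and
    the other is its dual vector. *)
Definition aa k b : P + P := if b == dir k then inl (inr k) else inr (inr k).

Lemma bsrc_aa k b : bsrc (aa k b) = pt k b.
Proof. by rewrite /aa; case: eqP => [->|] //=; case: b (dir k) => [] []. Qed.
Lemma btgt_aa k b : btgt (aa k b) = pt k (~~ b).
Proof. by rewrite /aa; case: eqP => [->|] //=; case: b (dir k) => [] []. Qed.

(** An arrow times its dual is the dual of the idempotent at its source, and the dual times the
    arrow is the one at its target. The result depends on [pt k b] alone, which is the commutativity
    relation between the two cycles at an edge. *)
Lemma aa_mul k b l c : vmul (td (aa k b)) (td (aa l c)) =
  if (k == l) && (c == ~~ b) then td (inr (inl (pt k b))) else 0.
Proof.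
case: ifP => [/andP[/eqP <- /eqP ->]|h].
  apply: te_mul => z; rewrite te_line_E /aa.
  by case dk: (dir k); case: b => /=; case: z => [[j|j]|[j|j]] //=; rewrite dk eqxx andbT.
apply: te_mul0 => z; rewrite te_line_E /aa.
case: eqP => hb; case: eqP => hc; case: z => [[j|j]|[j|j]] //; apply: contraFN h => /andP[_ /eqP E];
  rewrite E eqxx /=; move: hb hc; rewrite E; case: b c (dir l) => [] [] [] //.
Qed.

Lemma sink_mul i l c : vmul (td (inr (inl i))) (td (aa l c)) = 0.
Proof.
by apply: te_mul0 => z; rewrite te_line_E /aa; case: eqP => _; case: z => [[j|j]|[j|j]].
Qed.

Definition cyc k b : qpath BQ := (pt k b, [:: arr k b; arr k (~~ b)]).

Lemma around_cyc (k : 'I_m) b : around (inord k.+1 : bV line_graph) (pt k b) 2 (cyc k b).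
Proof.
split=> //=; congr [:: _; _]; congr pair; exact/esym/(qt_arr k b).
Qed.

Lemma cyc_valid k b : valid_path (cyc k b).
Proof. exact: around_valid (around_cyc k b). Qed.

Lemma end_cyc k b : end_vertex (cyc k b) = pt k b.
Proof. by rewrite -[LHS]/(qt (arr k (~~ b))) qt_arr negbK. Qed.

(** The two cycles at an inner edge are equal in the algebra and a normal form must pick one: the
    cycle around [i + 1], or around [i] for the last edge. *)
Let out_key (i : 'I_n) : 'I_m := inord (if (i < m)%N then i : nat else i.-1).

Lemma pt_out_key i : pt (out_key i) (i < m)%N = i.
Proof.
apply: val_inj; have hi := ltn_ord i; rewrite /= ptE /out_key; case: ltnP => im.
  by rewrite inordK.
by rewrite inordK; lia.
Qed.

Lemma arr_key_inj (k l : 'I_m) : inord k.+1 = inord l.+1 :> 'I_n.+1 -> k = l.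
Proof.
move=> /(congr1 val) /=; have hk := ltn_ord k; have hl := ltn_ord l.
by rewrite !inordK ?ltnS ?(ltnW hk) ?(ltnW hl) // => -[]; apply: val_inj.
Qed.

Lemma line_triv_ext_presentation : associative (@vmul K (monalg K (line_op dir))) ->
  presented_by T (@brauer_rels K line_graph).
Proof.
move=> vA; apply/presented_byP.
have TA : associative (@vmul K T) := triv_ext_assoc vA.
pose e (i : qv BQ) : vec T := td (inl (inl i)).
pose a (b : qa BQ) : vec T := td (aa (akey b) (aside b)).
have aE k b : a (arr k b) = td (aa k b) by rewrite /a akeyK asideK.
have ev1 k b : eval_path e a (pt k b, [:: arr k b]) = td (aa k b).
  by rewrite /eval_path /= aE /e line_idem_l bsrc_aa eqxx.
have ev2 k b l c : eval_path e a (pt k b, [:: arr k b; arr l c]) =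
    if (k == l) && (c == ~~ b) then td (inr (inl (pt k b))) else 0.
  by rewrite -aa_mul -ev1 -[td (aa l c)]aE.
(* Two arrows already give zero or a socle element, and any further arrow kills the latter. *)
have ev3 i b1 b2 b3 s : valid_path ((i, [:: b1, b2, b3 & s]) : qpath BQ) ->
    eval_path e a (i, [:: b1, b2, b3 & s]) = 0.
  rewrite /valid_path /= => /andP[/eqP <- _].
  rewrite -(arrK b1) -(arrK b2) -(arrK b3); move: (akey _) (aside _) => k b.
  rewrite /eval_path /= -[foldl _ _ s]/(foldl (fun acc al => vmul acc (a al))
     (vmul (eval_path e a (pt k b, [:: arr k b; arr (akey b2) (aside b2)]))
       (a (arr (akey b3) (aside b3)))) s).
  rewrite ev2 aE; have -> t : vmul (if t then td (inr (inl (pt k b))) else 0)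
      (td (aa (akey b3) (aside b3))) = 0 by case: t; rewrite ?sink_mul ?vmul0l.
  by elim: s => //= x s IH; rewrite vmul0l.
pose N (x : fd_basis T) : qpath BQ :=
  match x with
  | inl (inl i) => (i, [::])
  | inl (inr k) => (pt k (dir k), [:: arr k (dir k)])
  | inr (inr k) => (pt k (~~ dir k), [:: arr k (~~ dir k)])
  | inr (inl i) => cyc (out_key i) (i < m)%N
  end.
have v1 k b : valid_path ((pt k b, [:: arr k b]) : qpath BQ).
  exact: (valid_arrow (arr k b)).
have key_of (b : qa BQ) : (val b).1 = inord (akey b).+1.
  by rewrite -{1}(arrK b).
have around2 v i p : (1 < bdeg v)%N -> around v i (bdeg v) p -> exists k b, p = cyc k b.
  move=> dv; have d2 : bdeg v = 2%N by apply/eqP; rewrite eqn_leq dv (line_deg v line_is_line).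
  rewrite d2; case: p => j [|b [|c [|? ?]]] [/= -> ] // [bE' cE'].
  have bE : val b = (v, i) := bE'; have cE : val c = (v, bsucc v i) := cE'.
  exists (akey b), (aside b); rewrite /cyc.
  have -> : i = pt (akey b) (aside b) by rewrite -[i]/((v, i).2) -bE -{1}(arrK b).
  rewrite arrK; congr (_, [:: _; _]).
  have kE : akey c = akey b by rewrite /akey bE cE.
  rewrite -(arrK c) kE; congr arr; apply: (@pt_inj _ (akey b)).
  have := qt_arr (akey b) (aside b); rewrite arrK => <-.
  by rewrite -[in LHS]kE -[LHS]qs_arr arrK /= cE bE.
exists e, a; apply: (@std_presentation K T BQ _ e a TA _ _ _ _ N).
- by move=> i j; rewrite /e line_idem_l /=; case: eqP => // ->.
- move=> b; rewrite /e /a line_idem_r btgt_aa -qt_arr arrK.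
  by rewrite eqxx.
- exact: (unit_basis line_idem_l line_idem_r).
(* Both cycles at an edge [i] evaluate to the dual of the idempotent at [i]; a cycle followed by its
   first arrow has length three; arrows around different vertices have different keys. *)
- move=> g [|[]].
  + case=> i [v [v' [p [q [vv' _ /andP[dv dv'] [pv qv] ->]]]]].
    have [pi _] := pv; have [qi _] := qv.
    rewrite /valid_formal /= (around_valid pv) (around_valid qv); split=> //.
    have [k [b pE]] := around2 _ _ _ dv pv; have [l [c qE]] := around2 _ _ _ dv' qv.
    rewrite evf_cons evf1 /= pE qE !ev2 !eqxx /= vscale1 vscaleN1.
    by move: pi qi; rewrite pE qE /= => -> ->; rewrite subrr.
  + case=> i [v [p [_ dv pv ->]]]; have vp := around_valid pv.
    rewrite /valid_formal /= vp evf1 vscale1; split=> //.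
    have [_ /(congr1 size)] := pv; rewrite !size_map size_iota.
    by case: p vp {pv} => j [|b1 [|b2 [|b3 s]]] vp //=; [move=> [E]; rewrite -E in dv..|rewrite ev3].
  + case=> b [c [bc kbc ->]].
    have vbc : valid_path (((val b).2, [:: b; c]) : qpath BQ).
      by rewrite /valid_path /= eqxx /= -bc eqxx.
    rewrite /valid_formal /= vbc evf1 vscale1; split=> //.
    rewrite -(arrK b) -(arrK c) ev2; case: eqP => // E; case/eqP: kbc.
    by rewrite !key_of E.
- by case=> [[i|k]|[i|k]] //=; apply: cyc_valid.
- case=> [[i|k]|[i|k]] //=.
  + by rewrite ev1 /aa eqxx.
  + by rewrite ev2 !eqxx pt_out_key.
  + by rewrite ev1 /aa; case: (dir k).
have same p q : p = q -> ideal_fun (@brauer_rels K line_graph) (fun w => (p == w)%:R - (q == w)%:R).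
  by move=> ->; apply: ideal_fun_ext (ideal_fun0 _) => w; rewrite subrr.
move=> [i [|b [|c [|d s]]]] vp.
- by right; exists (inl (inl i)); apply: same.
- right; have iE : i = pt (akey b) (aside b).
    by move: vp; rewrite /valid_path /= andbT => /eqP <-; rewrite -{1}(arrK b).
  have [ab|ab] := eqVneq (aside b) (dir (akey b)).
    by exists (inl (inr (akey b))); apply: same; rewrite /= -ab -iE arrK.
  exists (inr (inr (akey b))); apply: same; rewrite /= iE.
  have -> : ~~ dir (akey b) = aside b by move: ab; case: (aside b) (dir _) => [] [].
  by rewrite arrK.
- move: vp; rewrite -(arrK b) -(arrK c); move: (akey b) (aside b) (akey c) (aside c) => k u l w vp.
  have [iE st] : i = pt k u /\ pt l w = pt k (~~ u).
    move: vp; rewrite /valid_path => /and3P[/eqP h1 /eqP h2 _].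
    by split; [exact: esym h1|exact: etrans h2 (qt_arr k u)].
  (* Different keys give a zero relation; equal keys force opposite sides, hence a cycle at [i]. *)
  have [kl|kl] := eqVneq k l; last first.
    left; apply: (ideal_fun_ext _ (ideal_mono (p := (i, [::])) (q := (qs (arr k u), [:: arr k u; arr l w]))
       (r := (qt (arr l w), [::])) (rho := @brauer_rels K line_graph) _ _ _ _ _)) => //.
    right; right; exists (arr k u), (arr l w); split=> //.
      by have := st; rewrite -qt_arr -qs_arr => /= <-.
    by apply: contra_neq kl => /= /arr_key_inj.
  right; exists (inr (inl i)); rewrite -kl in st *.
  have wE : w = ~~ u by apply: pt_inj st.
  have pE : (i, [:: arr k u; arr k w]) = cyc k u by rewrite wE iE.
  rewrite pE [N _]/=; set k' := out_key i; set u' := (i < m)%N.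
  (* The cycle is the chosen one at [i], or else the other, and then the two differ by a
     commutativity relation. *)
  have [kk|kk] := eqVneq k k'.
    apply: same; rewrite kk; congr cyc; apply: (@pt_inj _ k').
    by rewrite pt_out_key iE kk.
  have iE' : i = pt k' u' by rewrite pt_out_key.
  have deg2 (h : 'I_m) : bdeg (inord h.+1 : bV line_graph) = 2%N.
    apply/eqP; rewrite eqn_leq (line_deg _ line_is_line).
    by have := arr_subproof h true => /andP[].
  apply: ideal_diff.
  + by rewrite /= -iE -iE'.
  + by rewrite !end_cyc -iE -iE'.
  left; exists i, (inord k.+1), (inord k'.+1), (cyc k u), (cyc k' u'); split=> //.
  + by apply: contra_neq kk => /arr_key_inj.
  + have /andP[] := arr_subproof k u; have /andP[] := arr_subproof k' u'.
    by rewrite -iE -iE' /= => -> _ ->.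
  + by rewrite !deg2.
  + by rewrite !deg2; split; [rewrite {1}iE|rewrite {1}iE']; apply: around_cyc.
- by left; apply: (line_long K line_is_line vp).
Qed.

End LineAlgebra.

Lemma long_paths_Fil (K : fieldType) (A : fdalg K) (Q : quiver) (rho : formal K Q -> Prop)
    (e : qv Q -> vec A) (a : qa Q -> vec A) N :
  presentation rho e a ->
  (forall p, valid_path p -> (N <= size p.2)%N -> ideal_fun rho (fun w => (p == w)%:R)) ->
  forall v, Fil e a N v -> v = 0.
Proof.
move=> [_ _ _ h] long; apply: Fil_ind => [|v w -> ->|c v ->|p vp Np]; rewrite ?addr0 ?vscale0r //.
rewrite -[LHS]vscale1 -evf1; apply/h; first by rewrite /valid_formal /= vp.
by apply: ideal_fun_ext (long p vp Np) => w; rewrite fcoef1 mul1r.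
Qed.

Lemma linA_presented (K : fieldType) (A : fdalg K) (Q : quiver) (r : qa Q -> qa Q -> bool)
    m (f : 'I_m.+1 -> qv Q) (g : 'I_m -> qa Q) :
  bijective f -> bijective g ->
  (forall k, qs (g k) = f (widen_ord (leqnSn m) k) /\ qt (g k) = f (lift ord0 k)) ->
  (forall b c, qt b = qs c -> ~~ r b c) ->
  presented_by A (length2_rels (K := K) r) -> presented_by A (@no_rels K (linA m.+1)).
Proof.
move=> fb gb gE nr; pose u (b : qa (linA m.+1)) : 'I_m := Ordinal (valP b : (_ < m)%N).
have ub : bijective u.
  have hk (k : 'I_m) : ((widen_ord (leqnSn m) k).+1 < m.+1)%N := ltn_ord k.
  exists (fun k => exist (fun i : 'I_m.+1 => (i.+1 < m.+1)%N) _ (hk k)) => [b|k];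
    by do 2?apply: val_inj.
apply: (@no_rels_transport K A (linA m.+1) Q f (g \o u) fb (bij_comp gb ub)) => // b; rewrite /=.
  by rewrite (gE _).1; congr f; apply: val_inj.
by rewrite (gE _).2; congr f; apply: val_inj.
Qed.

Theorem theorem3p9 (K : closedFieldType) (Q : quiver) (r : qa Q -> qa Q -> bool)
  (A : fdalg K) :
  is_tree_quiver Q -> gentle r -> (2 <= #|qv Q|)%N ->
  @presented_by K A Q (@length2_rels K Q r) ->
  (brauer_star_algebra (triv_ext A) <-> @presented_by K A (linA #|qv Q|) (@no_rels K _)) /\
  (brauer_line_algebra (triv_ext A) <-> rad_sq_zero A).
Proof.
move=> tree gen n2 presA; have [e [a prs]] := (presented_byP A _).1 presA.
have n0 : (0 < #|qv Q|)%N by apply: ltnW.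
have vA := pres_assoc prs.
split; split.
- move=> [G [wf [c [inc star]] /presented_byP[e' [a' prs']]]].
  have [out1 in1] := star_inj wf inc star.
  (* The nilpotency exponent is [bdeg c + 1], whatever the number of edges. *)
  have F0 := long_paths_Fil prs' (star_long K inc star).
  have [si ti] := uniserial_inj prs prs' F0 out1 in1.
  have [m [f [g [-> fb gb gE]]]] := linear_enumeration tree n0 si ti.
  apply: (linA_presented fb gb gE _ presA) => b b'.
  exact: (uniserial_norel prs prs' F0 out1).
- have [m mE] : exists m, #|qv Q| = m.+2 by exists #|qv Q|.-2; lia.
  rewrite mE => /linA_tri_iso iso.
  exists (star_graph m.+1); split; [exact: star_wf|exact: star_is_star|].
  apply: (alg_iso_presented (alg_iso_triv_ext iso)).
  by apply: star_triv_ext_presentation => //; apply: alg_iso_assoc iso vA.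
- move=> [G [_ line /presented_byP[e' [a' prs']]]].
  apply/(rad_sq_zeroP prs).
  (* Here the exponent is 3, as required by [Loewy3_rels]. *)
  have F0 := long_paths_Fil prs' (fun p => @line_long K G p line).
  exact: (Loewy3_rels prs prs' F0).
- move/(rad_sq_zeroP prs) => rall.
  have [m [f [g [mE fb gb gE]]]] := line_enumeration tree n0 gen rall.
  case: m f g mE fb gb gE => [|m] f g mE fb gb gE; first by rewrite mE in n2.
  (* The enumeration finds each arrow only up to direction; [dir] records the actual one. *)
  pose dir k := qs (g k) == f (widen_ord (leqnSn m.+1) k).
  have iso : alg_iso (monalg K (line_op dir)) A.
    apply: (line_iso presA rall fb gb) => k; rewrite /dir.
    case/orP: (gE k) => /andP[/eqP -> /eqP ->]; first by rewrite eqxx.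
    by rewrite (inj_eq (bij_inj fb)) -val_eqE /= /bump /= add1n gtn_eqF.
  exists (line_graph m); split; [exact: line_wf|exact: line_is_line|].
  apply: (alg_iso_presented (alg_iso_triv_ext iso)).
  by apply: line_triv_ext_presentation; apply: alg_iso_assoc iso vA.
Qed.
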